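(* Let $f\in L^1(SE(2))\cap L^2(SE(2))$ be an admissible function such that $\widetilde{f}\in L^2(\mathbb{Z}^2\backslash SE(2),\mu)$ and $\widehat{f}\in\mathcal{H}^1(0,\infty)$. Let $\mathbf{k}=(k_1,k_2,k_3)\in\mathbb{Z}^3$. Then: (1) If $\rho(k_1,k_2)\neq0$, then $$\langle\widetilde{f},\psi_\mathbf{k}\rangle=\sqrt{2\pi}\,e^{-\mathrm{i}k_3\Phi(k_1,k_2)}\sum_{n\in\mathbb{Z}}e^{-\mathrm{i}n\Phi(k_1,k_2)}\,\widehat{f}(2\pi\rho(k_1,k_2))_{n,-k_3},$$ where the series converges absolutely. (2) If $\rho(k_1,k_2)=0$, then $\langle\widetilde{f},\psi_\mathbf{k}\rangle=\sqrt{2\pi}\,\widehat{f}[k_3]$.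
   Context: $SE(2)=\mathbb{R}^2\rtimes SO(2)$ has elements $g=(\mathbf{x},\mathbf{R})$ with product $(\mathbf{x},\mathbf{R})\circ(\mathbf{x}',\mathbf{R}')=(\mathbf{x}+\mathbf{R}\mathbf{x}',\mathbf{R}\mathbf{R}')$; $g(x,y,\theta):=((x,y),\mathbf{R}_\theta)$ with $\mathbf{R}_\theta$ the rotation by $\theta$. The Haar measure is $dg=\frac{1}{4\pi^2}dx\,dy\,d\theta$ ($\theta\in[0,2\pi)$), and $L^q(SE(2))$ refers to it. $L^2(\mathbb{S}^1)$ carries $\langle u,v\rangle=\frac{1}{2\pi}\int_0^{2\pi}u(\alpha)\overline{v(\alpha)}\,d\alpha$, with orthonormal basis $\mathbf{e}_k(\mathbf{u}_\alpha)=e^{\mathrm{i}k\alpha}$, $\mathbf{u}_\alpha=(\cos\alpha,\sin\alpha)$, $k\in\mathbb{Z}$. For $p>0$, $[U_p(\mathbf{t},\mathbf{R}_\theta)v](\mathbf{u})=e^{\mathrm{i}p\langle\mathbf{u},\mathbf{t}\rangle}v(\mathbf{R}_\theta^T\mathbf{u})$ defines a unitary representation of $SE(2)$ on $L^2(\mathbb{S}^1)$. For $f\in L^1(SE(2))$: $\widehat{f}(p):=\int_{SE(2)}f(g)U_p(g^{-1})\,dg$ (weak sense) for $p>0$; $\widehat{f}(p)_{n,m}:=\langle\widehat{f}(p)\mathbf{e}_n,\mathbf{e}_m\rangle$ for $n,m\in\mathbb{Z}$; $\widehat{f}_{n,m}$ is the function $p\mapsto\widehat{f}(p)_{n,m}$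 on $(0,\infty)$, and $\|\widehat{f}_{n,m}\|_\infty=\sup_{p>0}|\widehat{f}(p)_{n,m}|$; and for $n\in\mathbb{Z}$, $\widehat{f}[n]:=\int_{SE(2)}f(g(x,y,\theta))e^{-\mathrm{i}n\theta}\,dg$. $\mathcal{H}^1(0,\infty)$ is the space of measurable fields $F$ of bounded operators $F(p)$ on $L^2(\mathbb{S}^1)$, $p>0$, with $\int_0^\infty\|F(p)\|_1\,p\,dp<\infty$, $\|\cdot\|_1$ the trace norm. A function $f\in L^1(SE(2))$ is admissible if $\sup_{m\in\mathbb{Z}}\beta_m(f)<\infty$, where $\beta_m(f):=\sum_{n\in\mathbb{Z}}\|\widehat{f}_{n,m}\|_\infty$. $\mathbb{Z}^2$ is identified with the subgroup $\{g(\gamma_1,\gamma_2,0):\gamma_1,\gamma_2\in\mathbb{Z}\}$; $\mathbb{Z}^2\backslash SE(2)=\{\mathbb{Z}^2g\}$ is the right coset space. For $f\in L^1(SE(2))$, $\widetilde{f}(\mathbb{Z}^2g):=\sum_{\gamma\in\mathbb{Z}^2}f(\gamma\circ g)$ (a.e. defined). $\mu$ is the unique finite $SE(2)$-invariant (under right translation) Radon measure on $\mathbb{Z}^2\backslash SE(2)$ with $\int_{\mathbb{Z}^2\backslash SE(2)}\widetilde{f}\,d\mu=\int_{SE(2)}f\,dg$ for all $f\in L^1(SE(2))$; $\langle\psi,\varphi\rangle=\int\psi\overline{\varphi}\,d\mu$. For $\mathbf{k}=(k_1,k_2,k_3)\in\mathbb{Z}^3$, $\psi_\mathbf{k}(\mathbb{Z}^2g(x,y,\theta)):=\sqrt{2\pi}\,e^{2\pi\mathrm{i}(k_1x+k_2y)}e^{\mathrm{i}k_3\theta}$.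 For $(x,y)\in\mathbb{R}^2$, $\rho(x,y)\ge0$ and $\Phi(x,y)\in[0,2\pi)$ are the polar coordinates: $x=\rho(x,y)\cos\Phi(x,y)$, $y=\rho(x,y)\sin\Phi(x,y)$. *)

(* Defs.v *)
From HB Require Import structures.
From mathcomp Require Import all_boot all_order all_algebra.
From mathcomp Require Import complex generic_quotient.
From mathcomp Require Import all_classical all_reals all_analysis.
From mathcomp Require Import measurable_realfun.

Set Implicit Arguments.
Unset Strict Implicit.
Unset Printing Implicit Defensive.
Import Order.TTheory GRing.Theory Num.Theory.
Import numFieldNormedType.Exports.
Import ComplexField.

Local Open Scope classical_set_scope.
Local Open Scope ring_scope.

(** * Complex-valued integration and summation *)

Definition expi {R : realType} (t : R) : R[i] := Complex (cos t) (sin t).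

Section complex_integral.
Context {R : realType} {d} {T : measurableType d}.
Implicit Types (mu : {measure set T -> \bar R}) (f : T -> R[i]).

(* Integrals are componentwise. *)
Definition Cintegral mu f : R[i] :=
  Complex (\int[mu]_x complex.Re (f x)) (\int[mu]_x complex.Im (f x)).

Definition Cmeasurable (D : set T) f : Prop :=
  measurable_fun D (fun x => complex.Re (f x)) /\
  measurable_fun D (fun x => complex.Im (f x)).

Definition Cinner mu f g : R[i] := Cintegral mu (fun x => f x * conjc (g x)).

(* The space of measurable f with finite L^q norm; elements are functions, not
   almost-everywhere classes. *)
Definition Lq mu (q : \bar R) f : Prop :=
  Cmeasurable setT f /\ finite_norm mu q (fun x => Normc.normc (f x)).

End complex_integral.

Section complex_sum.
Context {R : realType} {T : choiceType}.
Implicit Types a : T -> R[i].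

(* Absolute (equivalently, unconditional) convergence. *)
Definition Csummable a : Prop :=
  summable setT (fun t => (Normc.normc (a t))%:E).

Definition rsum (a : T -> R) : R :=
  fine (\esum_(t in setT) (Num.max (a t) 0)%:E)
  - fine (\esum_(t in setT) (Num.max (- a t) 0)%:E).

(* The sum of a when Csummable a. *)
Definition Csum a : R[i] :=
  Complex (rsum (fun t => complex.Re (a t))) (rsum (fun t => complex.Im (a t))).

End complex_sum.

(** * The plane *)

Section plane.
Context {R : realType}.

Definition vec2 (x y : R) : 'cV[R]_2 := \col_i (if i == 0 then x else y).

Definition dot (u t : 'cV[R]_2) : R := (u^T *m t) 0 0.

Definition rotmx (t : R) : 'M[R]_2 :=
  \matrix_(i, j) (if i == j then cos t else if i == 0 then - sin t else sin t).

Definition polar_rho (x y : R) : R := Num.sqrt (x ^+ 2 + y ^+ 2).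

(* Unspecified in [0, 2 pi[ at the origin. *)
Definition polar_Phi (x y : R) : R :=
  xget 0 [set t | [/\ 0 <= t < 2 * pi,
                      x = polar_rho x y * cos t & y = polar_rho x y * sin t]].

End plane.

(** * The group SE(2) *)

Section SE2_def.
Variable R : realType.

Definition SO2_set : set 'M[R]_2 := [set A | A^T *m A = 1%:M /\ \det A = 1].
Definition SO2 : Type := set_type SO2_set.
HB.instance Definition _ := Choice.on SO2.
HB.instance Definition _ := Topological.on SO2.

Definition SE2 : Type := ('cV[R]_2 * SO2)%type.
HB.instance Definition _ := Choice.on SE2.
HB.instance Definition _ := Topological.on SE2.

End SE2_def.
Arguments SO2_set R : clear implicits.

Section SE2_group.
Context {R : realType}.
Implicit Types (A B : SO2 R) (g h : SE2 R).

Lemma SO2P A : (val A)^T *m val A = 1%:M /\ \det (val A) = 1.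
Proof. exact: set_valP A. Qed.

Lemma SO2_mulmxT A : val A *m (val A)^T = 1%:M.
Proof. by apply: mulmx1C; have [] := SO2P A. Qed.

Lemma SO2_mul_subproof A B : val A *m val B \in SO2_set R.
Proof.
have [A1 A2] := SO2P A; have [B1 B2] := SO2P B.
apply/mem_set; split; last by rewrite det_mulmx A2 B2 mulr1.
by rewrite trmx_mul mulmxA -(mulmxA (val B)^T) A1 mulmx1.
Qed.

Lemma SO2_inv_subproof A : (val A)^T \in SO2_set R.
Proof.
have [A1 A2] := SO2P A; apply/mem_set; split; last by rewrite det_tr.
by rewrite trmxK SO2_mulmxT.
Qed.

Lemma SO2_one_subproof : (1%:M : 'M[R]_2) \in SO2_set R.
Proof. by apply/mem_set; split; rewrite ?trmx1 ?mulmx1 ?det1. Qed.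

Definition SO2_mul A B : SO2 R := SigSub (SO2_mul_subproof A B).
Definition SO2_inv A : SO2 R := SigSub (SO2_inv_subproof A).
Definition SO2_one : SO2 R := SigSub SO2_one_subproof.

Lemma rot_subproof (t : R) : rotmx t \in SO2_set R.
Proof.
apply/mem_set; split; last first.
  rewrite (expand_det_row _ 0) !big_ord_recl big_ord0 /cofactor !det_mx11 !mxE.
  rewrite /= addr0 expr0 mul1r expr1 mulN1r mulrN mulNr opprK -!expr2.
  exact: cos2Dsin2.
apply/matrixP => i j; rewrite !mxE !big_ord_recl big_ord0 !mxE /= addr0.
case: i => [[|[|//]] ?]; case: j => [[|[|//]] ?] /=.
- by rewrite -!expr2 cos2Dsin2.
- by rewrite mulrN mulrC addNr.
- by rewrite mulNr mulrC addNr.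
- by rewrite mulrNN -!expr2 addrC cos2Dsin2.
Qed.

Definition rot (t : R) : SO2 R := SigSub (rot_subproof t).

Definition SE2_mul g h : SE2 R :=
  (g.1 + val g.2 *m h.1, SO2_mul g.2 h.2).
Definition SE2_inv g : SE2 R :=
  (- ((val g.2)^T *m g.1), SO2_inv g.2).
Definition SE2_one : SE2 R := (0, SO2_one).

Lemma SE2_mulA : associative SE2_mul.
Proof.
move=> g h k; congr pair; last by apply: val_inj; rewrite /= mulmxA.
by rewrite /= mulmxDr addrA mulmxA.
Qed.

Lemma SE2_mul1g : left_id SE2_one SE2_mul.
Proof.
case=> x A; congr pair; last by apply: val_inj; rewrite /= mul1mx.
by rewrite /= mul1mx add0r.
Qed.

Lemma SE2_mulg1 : right_id SE2_one SE2_mul.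
Proof.
case=> x A; congr pair; last by apply: val_inj; rewrite /= mulmx1.
by rewrite /= mulmx0 addr0.
Qed.

Lemma SE2_mulVg : left_inverse SE2_one SE2_inv SE2_mul.
Proof.
case=> x A; congr pair; first by rewrite /= addNr.
by apply: val_inj => /=; have [] := SO2P A.
Qed.

Lemma SE2_mulgV : right_inverse SE2_one SE2_inv SE2_mul.
Proof.
case=> x A; congr pair; last by apply: val_inj; rewrite /= SO2_mulmxT.
by rewrite /= mulmxN mulmxA SO2_mulmxT mul1mx addrN.
Qed.

End SE2_group.

HB.instance Definition _ (R : realType) := isPointed.Build (SE2 R) SE2_one.
HB.instance Definition _ (R : realType) := isGroup.Build (SE2 R)
  (@SE2_mulA R) (@SE2_mul1g R) (@SE2_mulg1 R) (@SE2_mulVg R) (@SE2_mulgV R).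

(* The element g(x, y, theta). *)
Definition SE2_elt {R : realType} (x y t : R) : SE2 R := (vec2 x y, rot t).

(** * Haar measure *)

HB.instance Definition _ (R : realType) :=
  Measurable.copy (SE2 R) (g_sigma_algebraType (@open (SE2 R))).

Section haar.
Variable R : realType.
Local Notation mR := (measurableTypeR R).
Local Notation leb := (@lebesgue_measure R).

Lemma open_measurable3 (U : set (R * R * R)) :
  open U -> measurable (U : set (mR * mR * mR)).
Proof.
move=> oU.
pose B (i : rat * rat * rat * nat) : set (R * R * R) :=
  ball (ratr i.1.1.1 : R) i.2.+1%:R^-1 `*` ball (ratr i.1.1.2 : R) i.2.+1%:R^-1
  `*` ball (ratr i.1.2 : R) i.2.+1%:R^-1.
rewrite (_ : U = \bigcup_i if `[< B i `<=` U >] then B i else set0).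
  apply: (@countable_bigcupT_measurable _ (mR * mR * mR)%type) => // i.
  case: asboolP => _; last exact: measurable0.
  by do 2 (apply: measurableX; last exact: measurable_ball);
    exact: measurable_ball.
apply/seteqP; split=> [|z [i _]]; last by case: asboolP => // + Bz; exact.
move=> [[x y] t] Uz; have [e /= e0 eU] := (nbhs_ballP _ _).1 (open_nbhs_nbhs (conj oU Uz)).
have [n /= ne] : exists n, n.+1%:R^-1 < e / 2.
  have e20 : 0 < e / 2 by rewrite divr_gt0.
  exists (Num.truncn (e / 2)^-1); rewrite invf_plt ?posrE// truncnS_gt//.
have n0 : (0 : R) < n.+1%:R^-1 by rewrite invr_gt0.
have approx (a : R) : exists q : rat, ball (ratr q : R) n.+1%:R^-1 a.
  have [|q] := @rat_in_itvoo R (a - n.+1%:R^-1) (a + n.+1%:R^-1).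
    by rewrite ltrBlDr -addrA ltrDl addr_gt0.
  rewrite in_itv /= => /andP[q1 q2]; exists q; rewrite /ball /= ltr_norml.
  by rewrite ltrBlDr ltrBrDr addrC -ltrBlDr q1 /= ltrBlDr addrC q2.
have [q1 b1] := approx x; have [q2 b2] := approx y; have [q3 b3] := approx t.
have close (a : R) (q : rat) (b : R) :
    ball (ratr q : R) n.+1%:R^-1 a -> ball (ratr q : R) n.+1%:R^-1 b -> ball a e b.
  move=> /ball_sym ha hb; rewrite [e]splitr.
  by apply: le_ball (ball_triangle ha hb); rewrite lerD// ltW.
exists (q1, q2, q3, n) => //=; case: asboolP => [_|]; first by [].
case=> -[[x' y'] t'] [[/= h1 h2] h3]; apply: eU.
by split=> /=; [split=> /=|]; [exact: close h1|exact: close h2|exact: close h3].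
Qed.

Definition SE2_param (z : mR * mR * mR) : SE2 R := SE2_elt z.1.1 z.1.2 z.2.

Lemma SE2_param_continuous :
  continuous (SE2_param : R * R * R -> SE2 R).
Proof.
have mxc (T : topologicalType) m n (f : T -> 'M[R]_(m, n)) :
    (forall i j, continuous (fun t => f t i j)) -> continuous f.
  move=> cf t A [P Pn PA]; apply: (filterS (P := fun s => forall i j, P i j (f s i j))).
    by move=> s Ps; apply: PA.
  apply: filter_forall => i; apply: filter_forall => j.
  exact: (cf i j t) (Pn i j).
have c1 : continuous (fun z : R * R * R => vec2 z.1.1 z.1.2).
  apply: mxc => i j.
  have -> : (fun z : R * R * R => vec2 z.1.1 z.1.2 i j) =
            (fun z => if i == 0 then z.1.1 else z.1.2).
    by apply/funext => z; rewrite mxE.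
  case: (i == 0) => z.
    by apply: (@continuous_comp _ _ _ fst fst); exact: cvg_fst.
  by apply: (@continuous_comp _ _ _ fst snd); [exact: cvg_fst|exact: cvg_snd].
have c2 : continuous (fun z : R * R * R => rot z.2 : SO2 R).
  apply: continuous_comp_initial; apply: mxc => i j z.
  apply: (@continuous_comp _ _ _ snd (fun t => rotmx t i j)).
    exact: cvg_snd.
  have -> : (fun t : R => rotmx t i j) = (fun t => if i == j then cos t
      else if i == 0 then - sin t else sin t).
    by apply/funext => t; rewrite mxE.
  case: (i == j); first exact: continuous_cos.
  case: (i == 0); last exact: continuous_sin.
  by apply: cvgN; exact: continuous_sin.
move=> z A [[P Q] [/= Pn Qn] PQ].
apply: (filterS (P := [set w : R * R * R |
    P (vec2 w.1.1 w.1.2) /\ Q (rot w.2)])); first by move=> w [Pw Qw]; apply: PQ.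
by apply: filterI; [exact: (c1 z P Pn)|exact: (c2 z Q Qn)].
Qed.

Lemma SE2_param_measurable : measurable_fun setT SE2_param.
Proof.
apply: (@measurability _ _ _ _ _ _ (@open (SE2 R))) => //.
move=> _ [U oU <-]; rewrite setTI; apply: open_measurable3.
by move/continuousP: SE2_param_continuous; apply.
Qed.

Definition SE2_chart : set (mR * mR * mR) := setT `*` `[0, 2 * pi[.

Lemma measurable_SE2_chart : measurable SE2_chart.
Proof. by apply: measurableX => //; exact: measurable_itv. Qed.

Lemma haar_cst_ge0 : 0 <= (4 * pi ^+ 2)^-1 :> R.
Proof. by rewrite invr_ge0 mulr_ge0 // exprn_ge0 // pi_ge0. Qed.

Definition haar : set (SE2 R) -> \bar R :=
  pushforward (mscale (NngNum haar_cst_ge0)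
    (mrestr (leb \x leb \x leb)%E measurable_SE2_chart)) SE2_param.


Let haar0 : haar set0 = 0%E.
Proof. by rewrite /haar /pushforward preimage_set0 measure0. Qed.

Let haar_ge0 A : (0 <= haar A)%E.
Proof. by rewrite /haar /pushforward; exact: measure_ge0. Qed.

Let haar_sigma_additive : semi_sigma_additive haar.
Proof.
have mp A : measurable A -> measurable (SE2_param @^-1` A).
  by move=> mA; rewrite -[X in measurable X]setTI; exact: SE2_param_measurable.
move=> F mF tF mUF; rewrite /haar /pushforward preimage_bigcup.
apply: measure_semi_sigma_additive.
- by move=> n; exact: mp.
- apply/trivIsetP => /= i j _ _ ij; rewrite -preimage_setI.
  by move/trivIsetP : tF => /(_ _ _ _ _ ij) ->//; rewrite preimage_set0.
- by rewrite -preimage_bigcup; exact: mp.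
Qed.

HB.instance Definition _ := isMeasure.Build _ _ _ haar
  haar0 haar_ge0 haar_sigma_additive.

End haar.

(** * The Hilbert space L^2(S^1) and its operators *)

Section circle.
Variable R : realType.
Local Notation mR := (measurableTypeR R).

Definition S1_set : set 'cV[R]_2 := [set u | dot u u = 1].
Definition S1 : Type := set_type S1_set.

Lemma S1_angle_subproof (a : R) : vec2 (cos a) (sin a) \in S1_set.
Proof.
apply/mem_set; rewrite /S1_set /= /dot !mxE !big_ord_recl big_ord0 !mxE /=.
by rewrite addr0 -!expr2 cos2Dsin2.
Qed.

(* The point u_a. *)
Definition S1_angle (a : R) : S1 := SigSub (S1_angle_subproof a).

Lemma S1_rot_subproof (A : SO2 R) (u : S1) : val A *m val u \in S1_set.
Proof.
have [A1 _] := SO2P A; have := set_valP u; rewrite /S1_set /= => u1.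
apply/mem_set; rewrite /S1_set /= -[RHS]u1 /dot trmx_mul mulmxA.
by rewrite -(mulmxA _ (val A)^T) A1 mulmx1.
Qed.

Definition S1_rot (A : SO2 R) (u : S1) : S1 := SigSub (S1_rot_subproof A u).

Lemma measurable_circle_itv : measurable (`[0, 2 * pi[ : set mR).
Proof. exact: measurable_itv. Qed.

Lemma circle_cst_ge0 : 0 <= (2 * pi)^-1 :> R.
Proof. by rewrite invr_ge0 mulr_ge0 // pi_ge0. Qed.

(* Functions on S^1 are integrated through their angular variable. *)
Definition circle_measure : set mR -> \bar R :=
  mscale (NngNum circle_cst_ge0)
    (mrestr (@lebesgue_measure R) measurable_circle_itv).
HB.instance Definition _ := Measure.on circle_measure.

Implicit Types (u v w : S1 -> R[i]).

Definition S1L2 v : Prop := Lq circle_measure 2%:E (v \o S1_angle).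
Definition S1inner u v : R[i] :=
  Cinner circle_measure (u \o S1_angle) (v \o S1_angle).
Definition S1norm v : \bar R :=
  Lnorm circle_measure 2%:E (fun a => (Normc.normc (v (S1_angle a)))%:E).
Definition S1ae_eq u v : Prop :=
  ae_eq circle_measure setT (u \o S1_angle) (v \o S1_angle).

Definition S1basis (k : int) : S1 -> R[i] := fun u : S1 =>
  expi (k%:~R * polar_Phi (val u 0 0) (val u 1 0)).

(* An operator acts on representatives; only its values on S1L2, up to S1ae_eq,
   are significant. *)
Definition S1op : Type := (S1 -> R[i]) -> (S1 -> R[i]).
HB.instance Definition _ := Choice.on S1op.

Definition bounded_op (T : S1op) : Prop :=
  [/\ forall v, S1L2 v -> S1L2 (T v),
      forall v w, S1L2 v -> S1L2 w -> S1ae_eq v w -> S1ae_eq (T v) (T w),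
      forall (a : R[i]) v w, S1L2 v -> S1L2 w ->
        S1ae_eq (T (fun x => a * v x + w x)) (fun x => a * T v x + T w x) &
      exists M : R, forall v, S1L2 v -> (S1norm (T v) <= M%:E * S1norm v)%E].

Definition positive_op (T : S1op) : Prop :=
  forall v, S1L2 v -> 0 <= S1inner (T v) v.

(* |T|, the positive square root of T^* T: S (S v) = T^* (T v). *)
Definition abs_op (T : S1op) : S1op :=
  xget (fun=> fun=> 0) [set S : S1op | [/\ bounded_op S, positive_op S &
    forall v w, S1L2 v -> S1L2 w -> S1inner (S (S v)) w = S1inner (T v) (T w)]].

Definition trace_norm (T : S1op) : \bar R :=
  \esum_(k in [set: int])
    (complex.Re (S1inner (abs_op T (S1basis k)) (S1basis k)))%:E.

Definition measurable_op_field (F : R -> S1op) : Prop :=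
  forall v w, S1L2 v -> S1L2 w ->
    Cmeasurable (`]0, +oo[ : set mR) (fun p => S1inner (F p v) w).

(* The space H^1(0, +oo). *)
Definition H1_field (F : R -> S1op) : Prop :=
  [/\ forall p, 0 < p -> bounded_op (F p),
      measurable_op_field F &
      (\int[@lebesgue_measure R]_(p in `]0%R, +oo[)
         (trace_norm (F p) * p%:E) < +oo)%E].

End circle.

(** * The Fourier transform on SE(2) *)

Section fourier.
Context {R : realType}.
Implicit Types (f : SE2 R -> R[i]) (p : R) (n m : int).

Definition Urep p (g : SE2 R) : S1op R := fun v u =>
  expi (p * dot (val u) g.1) * v (S1_rot (SO2_inv g.2) u).

(* The weak integral of f(g) U_p(g^-1): fourier f p v is the element w of
   L^2(S^1) such that <w, h> is the integral of f(g) <U_p(g^-1) v, h>. *)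
Definition fourier f p : S1op R := fun v =>
  xget (fun=> 0) [set w : S1 R -> R[i] | S1L2 w /\ forall h, S1L2 h ->
    S1inner w h =
    Cintegral (@haar R) (fun g => f g * S1inner (Urep p (g^-1)%g v) h)].

Definition fourier_coef f p n m : R[i] :=
  S1inner (fourier f p (S1basis n)) (S1basis m).

Definition fourier_coef_sup f n m : \bar R :=
  ereal_sup [set (Normc.normc (fourier_coef f p n m))%:E | p in [set p | 0 < p]].

Definition fourier_beta f m : \bar R :=
  \esum_(n in [set: int]) fourier_coef_sup f n m.

Definition admissible f : Prop :=
  Lq (@haar R) 1%:E f /\ (ereal_sup (range (fourier_beta f)) < +oo)%E.

(* The angle theta in [0, 2 pi[ of the rotation part: the first column of R_theta
   is (cos theta, sin theta). *)
Definition SE2_theta (g : SE2 R) : R := polar_Phi (val g.2 0 0) (val g.2 1 0).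

(* \hat f [n] *)
Definition theta_coef f n : R[i] :=
  Cintegral (@haar R) (fun g => f g * expi (- (n%:~R * SE2_theta g))).

End fourier.

(** * The coset space Z^2 \ SE(2) *)

Section cosets.
Local Open Scope quotient_scope.
Variable R : realType.
Implicit Types (g h : SE2 R) (c : int * int).

Definition Z2_elt c : SE2 R := SE2_elt c.1%:~R c.2%:~R 0.

Lemma rotmx0 : rotmx (0 : R) = 1%:M.
Proof.
apply/matrixP => i j; rewrite !mxE cos0 sin0 oppr0.
by case: (i == j); case: (i == 0).
Qed.

Lemma Z2_eltD c c' :
  (Z2_elt c * Z2_elt c')%g = Z2_elt (c.1 + c'.1, c.2 + c'.2).
Proof.
congr pair; last by apply: val_inj; rewrite /= rotmx0 mulmx1.
rewrite /= rotmx0 mul1mx; apply/matrixP => i j; rewrite !mxE.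
by case: (i == 0); rewrite -intrD.
Qed.

Lemma Z2_elt0 : Z2_elt (0, 0) = 1%g.
Proof.
congr pair; last by apply: val_inj; rewrite /= rotmx0.
by apply/matrixP => i j; rewrite !mxE; case: (i == 0).
Qed.

Definition Z2_rel g h : bool := `[< exists c, h = (Z2_elt c * g)%g >].

Lemma Z2_rel_refl : reflexive Z2_rel.
Proof. by move=> g; apply/asboolP; exists (0, 0); rewrite Z2_elt0 mul1g. Qed.

Lemma Z2_rel_sym : symmetric Z2_rel.
Proof.
suff H g h : Z2_rel g h -> Z2_rel h g by move=> g h; apply/idP/idP; exact: H.
move=> /asboolP[c ->]; apply/asboolP; exists (- c.1, - c.2).
by rewrite mulgA Z2_eltD /= !addNr Z2_elt0 mul1g.
Qed.

Lemma Z2_rel_trans : transitive Z2_rel.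
Proof.
move=> h g k /asboolP[c ->] /asboolP[c' ->]; apply/asboolP.
by exists (c'.1 + c.1, c'.2 + c.2); rewrite mulgA Z2_eltD.
Qed.

Definition Z2_equiv : equiv_rel (SE2 R) :=
  EquivRel Z2_rel Z2_rel_refl Z2_rel_sym Z2_rel_trans.

Definition coset_space : Type := quotient_topology {eq_quot Z2_equiv}.
HB.instance Definition _ := Choice.on coset_space.
HB.instance Definition _ :=
  Quotient.copy coset_space (quotient_topology {eq_quot Z2_equiv}).
HB.instance Definition _ := Topological.on coset_space.
HB.instance Definition _ := Pointed.on coset_space.
HB.instance Definition _ :=
  Measurable.copy coset_space (g_sigma_algebraType (@open coset_space)).

Definition Z2_coset (g : SE2 R) : coset_space := (\pi_coset_space g)%qT.

Definition coset_act (q : coset_space) (h : SE2 R) : coset_space :=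
  Z2_coset (repr q * h)%g.

(* \tilde f *)
Definition periodization (f : SE2 R -> R[i]) (q : coset_space) : R[i] :=
  Csum (fun c : int * int => f (Z2_elt c * repr q)%g).

Definition psi (k1 k2 k3 : int) (q : coset_space) : R[i] :=
  let g := repr q in
  (Num.sqrt (2 * pi))%:C%C
  * expi (2 * pi * (k1%:~R * g.1 0 0 + k2%:~R * g.1 1 0))
  * expi (k3%:~R * SE2_theta g).

Definition radon_measure (mu : {measure set coset_space -> \bar R}) : Prop :=
  [/\ forall K, compact K -> (mu K < +oo)%E,
      forall A, measurable A ->
        mu A = ereal_inf [set mu U | U in [set U | open U /\ A `<=` U]] &
      forall U, open U ->
        mu U = ereal_sup [set mu K | K in [set K | compact K /\ K `<=` U]]].

(* These conditions determine mu. *)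
Definition invariant_coset_measure
    (mu : {measure set coset_space -> \bar R}) : Prop :=
  [/\ (mu setT < +oo)%E,
      radon_measure mu,
      forall h A, measurable A -> mu (coset_act^~ h @^-1` A) = mu A &
      forall f, Lq (@haar R) 1%:E f ->
        Lq mu 1%:E (periodization f) /\
        Cintegral mu (periodization f) = Cintegral (@haar R) f].

End cosets.

(* Main.v *)
(* Unfolding turns the inner product on the quotient into an integral of [f]
   over SE(2) against the conjugate of a lattice-invariant function; this rests
   on the almost everywhere absolute convergence of the periodization series.
   For [p = 2 pi rho] and a rotation angle [theta] of [g], the sum over [n] of
   [e^(-i n Phi) <U_p(g^-1) e_n, e_m>] is the Fourier series, at
   [Phi - theta], of the smooth function
   [a |-> e^(-i p <u_(a+theta), x>) e^(-i m a)].  Its Fejer means converge with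
   an explicit bound, because the Fejer kernel is nonnegative and its moment
   against [1 - cos] tends to [0]; dominated convergence then carries the limit
   through the integral over SE(2), while the Fejer means of the absolutely
   summable coefficients of [f] converge to the sum of the series. *)
Require Import Defs.
From HB Require Import structures.
From mathcomp Require Import all_boot all_order all_algebra.
From mathcomp Require Import complex generic_quotient.
From mathcomp Require Import all_classical all_reals all_analysis.
From mathcomp Require Import measurable_realfun.
From mathcomp Require Import ring lra zify finmap.

Set Implicit Arguments.
Unset Strict Implicit.
Unset Printing Implicit Defensive.
Import Order.TTheory GRing.Theory Num.Theory.
Import numFieldNormedType.Exports.

Local Open Scope classical_set_scope.
Local Open Scope ring_scope.

(** Sum and integral cannot be exchanged by absolute domination. At fixed g the pointwise Fourier
    coefficients are, up to phases, Bessel values at p|x|; their absolute sum is unbounded in x,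
    while f is only integrable. Admissibility controls the coefficients after integration over g,
    not before. Averaging with a positive kernel of mass one keeps the means bounded independently
    of g, so a multiple of |f| dominates; the rate of convergence, whose constant grows like |x|^2,
    is needed only pointwise. On the quotient side, null sets and measurability are accessible only
    through the identity between the integral of a periodization and the integral over the group. It
    is tested on functions cut off to one unit cell: their periodization has at most one nonzero
    term, so no convergence question arises. Since [Csum] gives a finite value even to a divergent
    series, almost everywhere convergence cannot be read off from integrability of the periodization
    and needs its own proof. *)

Local Notation Re := complex.Re.
Local Notation Im := complex.Im.
Local Notation normc := Normc.normc.

(** * Complex-valued integrals *)

Section complex_numbers.
Context {R : realType}.
Implicit Types (z w : R[i]) (s t : R).

Lemma ReD z w : Re (z + w) = Re z + Re w. Proof. by case: z; case: w. Qed.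
Lemma ImD z w : Im (z + w) = Im z + Im w. Proof. by case: z; case: w. Qed.
Lemma ReN z : Re (- z) = - Re z. Proof. by case: z. Qed.
Lemma ImN z : Im (- z) = - Im z. Proof. by case: z. Qed.

Lemma ReM z w : Re (z * w) = Re z * Re w - Im z * Im w.
Proof. by case: z; case: w. Qed.

Lemma ImM z w : Im (z * w) = Re z * Im w + Im z * Re w.
Proof. by case: z; case: w. Qed.

Lemma Re_conjc z : Re (conjc z) = Re z. Proof. by case: z. Qed.
Lemma Im_conjc z : Im (conjc z) = - Im z. Proof. by case: z. Qed.

Lemma ReZ s z : Re (s%:C%C * z) = s * Re z.
Proof. by rewrite ReM /= mul0r subr0. Qed.

Lemma ImZ s z : Im (s%:C%C * z) = s * Im z.
Proof. by rewrite ImM /= mul0r addr0. Qed.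

Lemma eqC z w : Re z = Re w -> Im z = Im w -> z = w.
Proof. by case: z; case: w => ? ? ? ? /= -> ->. Qed.

Lemma Re_sum (I : Type) (r : seq I) (F : I -> R[i]) :
  Re (\sum_(i <- r) F i) = \sum_(i <- r) Re (F i).
Proof. exact: (big_morph _ ReD). Qed.

Lemma Im_sum (I : Type) (r : seq I) (F : I -> R[i]) :
  Im (\sum_(i <- r) F i) = \sum_(i <- r) Im (F i).
Proof. exact: (big_morph _ ImD). Qed.

Lemma normcE z : normc z = Num.sqrt (Re z ^+ 2 + Im z ^+ 2).
Proof. by case: z. Qed.

Lemma normc_ge0 z : 0 <= normc z.
Proof. by rewrite normcE sqrtr_ge0. Qed.

Lemma normr_Re_le z : `|Re z| <= normc z.
Proof. by rewrite normcE -sqrtr_sqr ler_wsqrtr// lerDl sqr_ge0. Qed.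

Lemma normr_Im_le z : `|Im z| <= normc z.
Proof. by rewrite normcE -sqrtr_sqr ler_wsqrtr// lerDr sqr_ge0. Qed.

Lemma normc_le_ReIm z : normc z <= `|Re z| + `|Im z|.
Proof.
rewrite -[leRHS]ger0_norm ?addr_ge0// -sqrtr_sqr normcE ler_wsqrtr//.
by rewrite sqrrD !real_normK ?num_real// addrAC lerDl mulrn_wge0// mulr_ge0.
Qed.

Lemma normc_leD z w : normc (z + w) <= normc z + normc w.
Proof. exact: (@le_normcD R z w). Qed.

Lemma normc_opp z : normc (- z) = normc z.
Proof. exact: (@normcN R z). Qed.

Lemma normc_conjc z : normc (conjc z) = normc z.
Proof. by rewrite !normcE Re_conjc Im_conjc sqrrN. Qed.

Lemma normc_real s : normc s%:C%C = `|s|.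
Proof. by rewrite normcE /= expr0n addr0 sqrtr_sqr. Qed.

Lemma expiD s t : expi (s + t) = expi s * expi t :> R[i].
Proof. by apply: eqC; rewrite ?ReM ?ImM /= ?cosD ?sinD// [RHS]addrC. Qed.

Lemma expiN t : expi (- t) = conjc (expi t) :> R[i].
Proof. by rewrite /expi cosN sinN. Qed.

Lemma expi0 : expi 0 = 1 :> R[i].
Proof. by rewrite /expi cos0 sin0. Qed.

Lemma normc_expi t : normc (expi t) = 1.
Proof. by rewrite normcE /= cos2Dsin2 sqrtr1. Qed.

Lemma expi_period t (n : int) : expi (t + n%:~R * (2 * pi)) = expi t :> R[i].
Proof.
have P s : expi (s + 2 * pi) = expi s :> R[i].
  by rewrite mulr_natl /expi cosD2pi sinD2pi.
have H (m : nat) s : expi (s + m%:R * (2 * pi)) = expi s :> R[i].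
  elim: m => [|m IH]; first by rewrite mul0r addr0.
  by rewrite -natr1 mulrDl mul1r addrA P.
case: n => n; first exact: H.
by rewrite -[in RHS](subrK (n.+1%:R * (2 * pi)) t) H NegzE mulrNz mulNr.
Qed.

End complex_numbers.

Section complex_measurable.
Context {R : realType} {d} {T : measurableType d}.
Implicit Types (D : set T) (f g : T -> R[i]).

Lemma Cmeasurable_cst D (z : R[i]) : Cmeasurable D (fun=> z).
Proof. by split; exact: measurable_cst. Qed.

Lemma CmeasurableD D f g : Cmeasurable D f -> Cmeasurable D g ->
  Cmeasurable D (fun x => f x + g x).
Proof.
move=> [f1 f2] [g1 g2]; split.
  by under eq_fun do rewrite ReD; exact: measurable_funD.
by under eq_fun do rewrite ImD; exact: measurable_funD.
Qed.

Lemma CmeasurableM D f g : Cmeasurable D f -> Cmeasurable D g ->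
  Cmeasurable D (fun x => f x * g x).
Proof.
move=> [f1 f2] [g1 g2]; split.
  by under eq_fun do rewrite ReM; apply: measurable_funB; exact: measurable_funM.
by under eq_fun do rewrite ImM; apply: measurable_funD; exact: measurable_funM.
Qed.

Lemma Cmeasurable_conjc D f : Cmeasurable D f ->
  Cmeasurable D (fun x => conjc (f x)).
Proof.
move=> [f1 f2]; split; first by under eq_fun do rewrite Re_conjc.
by under eq_fun do rewrite Im_conjc; exact: measurableT_comp.
Qed.

Lemma Cmeasurable_real D (h : T -> R) : measurable_fun D h ->
  Cmeasurable D (fun x => (h x)%:C%C).
Proof. by move=> mh; split=> //=; exact: measurable_cst. Qed.

Lemma Cmeasurable_expi D (h : T -> R) : measurable_fun D h ->
  Cmeasurable D (fun x => expi (h x)).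
Proof.
move=> mh; split; apply: measurableT_comp => //; apply: continuous_measurable_fun.
  exact: continuous_cos.
exact: continuous_sin.
Qed.

Lemma measurable_normc D f : Cmeasurable D f ->
  measurable_fun D (fun x => normc (f x)).
Proof.
move=> [f1 f2]; under eq_fun do rewrite normcE.
have ms : measurable_fun D (fun x => Re (f x) ^+ 2 + Im (f x) ^+ 2).
  by apply: measurable_funD; exact: measurable_funX.
apply: (measurableT_comp _ ms); apply: continuous_measurable_fun.
exact: sqrt_continuous.
Qed.

Lemma Cmeasurable_comp {d'} {T' : measurableType d'} (f : T' -> R[i])
    (h : T -> T') :
  measurable_fun setT h -> Cmeasurable setT f -> Cmeasurable setT (f \o h).
Proof.
move=> mh [f1 f2]; split; first exact: (measurableT_comp f1 mh).
exact: (measurableT_comp f2 mh).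
Qed.

End complex_measurable.

Section complex_integrable.
Context {R : realType} {d} {T : measurableType d}.
Variable mu : {measure set T -> \bar R}.
Implicit Types (f g : T -> R[i]) (h : T -> R).

Definition Cintegrable f : Prop :=
  mu.-integrable setT (fun x => (Re (f x))%:E) /\
  mu.-integrable setT (fun x => (Im (f x))%:E).

Lemma Cintegrable_measurable f : Cintegrable f -> Cmeasurable setT f.
Proof.
by move=> [f1 f2]; split; apply/measurable_EFinP;
  [exact: measurable_int f1|exact: measurable_int f2].
Qed.

Lemma le_Cintegrable f h : Cmeasurable setT f ->
  mu.-integrable setT (fun x => (h x)%:E) -> (forall x, normc (f x) <= h x) ->
  Cintegrable f.
Proof.
move=> [f1 f2] hi fh; split; apply: le_integrable hi => //.
- exact/measurable_EFinP.
- move=> x _; rewrite lee_fin; apply: (le_trans (normr_Re_le _)).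
  by rewrite (le_trans (fh x)) ?ler_norm.
- exact/measurable_EFinP.
- move=> x _; rewrite lee_fin; apply: (le_trans (normr_Im_le _)).
  by rewrite (le_trans (fh x)) ?ler_norm.
Qed.

Lemma Cintegrable_normc f : Cintegrable f ->
  mu.-integrable setT (fun x => (normc (f x))%:E).
Proof.
move=> fi; have [f1 f2] := fi.
have : mu.-integrable setT (fun x => (`|Re (f x)| + `|Im (f x)|)%:E).
  by under eq_fun do rewrite EFinD; apply: integrableD => //; exact: integrable_norm.
apply: le_integrable => //.
  by apply/measurable_EFinP; apply: measurable_normc; exact: Cintegrable_measurable.
move=> x _; rewrite lee_fin ger0_norm ?normc_ge0// ger0_norm ?addr_ge0//.
exact: normc_le_ReIm.
Qed.

Lemma Lq1P f : Lq mu 1%:E f <-> Cintegrable f.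
Proof.
have nE : (\int[mu]_x `| (EFin \o (fun x => normc (f x))) x | =
          \int[mu]_x `| (normc (f x))%:E |)%E by [].
split=> [[mf]|fi].
  rewrite /finite_norm Lnorm1 nE => fin.
  apply: (@le_Cintegrable _ (fun x => normc (f x))) => //.
  by apply/integrableP; split => //; apply/measurable_EFinP; exact: measurable_normc.
split; first exact: Cintegrable_measurable.
rewrite /finite_norm Lnorm1 nE.
by have /integrableP[] := Cintegrable_normc fi.
Qed.

Lemma CintegrableM f g (M : R) : Cintegrable f -> Cmeasurable setT g ->
  (forall x, normc (g x) <= M) -> Cintegrable (fun x => f x * g x).
Proof.
move=> fi mg gM; apply: (@le_Cintegrable _ (fun x => M * normc (f x))).
- by apply: CmeasurableM => //; exact: Cintegrable_measurable.
- by under eq_fun do rewrite EFinM; apply: integrableZl => //; exact: Cintegrable_normc.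
- by move=> x; rewrite Normc.normcM mulrC ler_wpM2r ?normc_ge0.
Qed.

Lemma CintegrableD f g : Cintegrable f -> Cintegrable g ->
  Cintegrable (fun x => f x + g x).
Proof.
move=> [f1 f2] [g1 g2]; split.
  by under eq_fun do rewrite ReD EFinD; exact: integrableD.
by under eq_fun do rewrite ImD EFinD; exact: integrableD.
Qed.

Lemma CintegrableZ (z : R[i]) f : Cintegrable f -> Cintegrable (fun x => z * f x).
Proof.
move=> fi; under eq_fun do rewrite mulrC.
by apply: (@CintegrableM _ _ (normc z)) => //; exact: Cmeasurable_cst.
Qed.

Lemma Cintegrable0 : Cintegrable (fun=> 0).
Proof. by split => /=; exact: integrable0. Qed.

Lemma Cintegrable_sum (I : Type) (r : seq I) (F : I -> T -> R[i]) :
  (forall i, Cintegrable (F i)) -> Cintegrable (fun x => \sum_(i <- r) F i x).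
Proof.
move=> Fi; elim: r => [|i r IH].
  by under eq_fun do rewrite big_nil; exact: Cintegrable0.
by under eq_fun do rewrite big_cons; exact: CintegrableD.
Qed.

Lemma CintegralD f g : Cintegrable f -> Cintegrable g ->
  Cintegral mu (fun x => f x + g x) = Cintegral mu f + Cintegral mu g.
Proof.
move=> [f1 f2] [g1 g2]; apply: eqC; rewrite ?ReD ?ImD /=.
  by under eq_Rintegral do rewrite ReD; rewrite RintegralD.
by under eq_Rintegral do rewrite ImD; rewrite RintegralD.
Qed.

Lemma CintegralZ (z : R[i]) f : Cintegrable f ->
  Cintegral mu (fun x => z * f x) = z * Cintegral mu f.
Proof.
move=> [f1 f2]; have H (r : R) h : mu.-integrable setT (EFin \o h) ->
    mu.-integrable setT (EFin \o (fun x => r * h x)).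
  by move=> hi; exact: (@integrableZl _ _ _ mu setT measurableT r _ hi).
apply: eqC; rewrite ?ReM ?ImM /=.
  under eq_Rintegral do rewrite ReM.
  by rewrite RintegralB//; [rewrite !RintegralZl|exact: H|exact: H].
under eq_Rintegral do rewrite ImM.
by rewrite RintegralD//; [rewrite !RintegralZl|exact: H|exact: H].
Qed.

Lemma CintegralZr (z : R[i]) f : Cintegrable f ->
  Cintegral mu (fun x => f x * z) = Cintegral mu f * z.
Proof.
by move=> fi; rewrite mulrC -CintegralZ//; congr Cintegral; apply/funext => x; rewrite mulrC.
Qed.

Lemma Cintegral0 : Cintegral mu (fun=> 0) = 0.
Proof. by rewrite /Cintegral Rintegral_cst// mul0r. Qed.

Lemma Cintegral_sum (I : Type) (r : seq I) (F : I -> T -> R[i]) :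
  (forall i, Cintegrable (F i)) ->
  Cintegral mu (fun x => \sum_(i <- r) F i x) = \sum_(i <- r) Cintegral mu (F i).
Proof.
move=> Fi; elim: r => [|i r IH].
  by rewrite big_nil; under eq_fun do rewrite big_nil; exact: Cintegral0.
rewrite big_cons -IH -CintegralD//; last exact: Cintegrable_sum.
by congr Cintegral; apply/funext => x; rewrite big_cons.
Qed.

(** The factor 2 comes from estimating real and imaginary parts separately. The sharp constant 1
    would gain nothing: only some fixed bound is needed later. *)
Lemma normc_Cintegral_le f h : Cintegrable f ->
  mu.-integrable setT (fun x => (h x)%:E) -> (forall x, normc (f x) <= h x) ->
  normc (Cintegral mu f) <= 2 * \int[mu]_x h x.
Proof.
move=> [f1 f2] hi fh; rewrite (le_trans (normc_le_ReIm _))// mulrDl mul1r lerD//.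
  rewrite (le_trans (le_normr_Rintegral _ f1))// le_Rintegral//.
    exact: integrable_norm.
  by move=> x _; rewrite (le_trans (normr_Re_le _)).
rewrite (le_trans (le_normr_Rintegral _ f2))// le_Rintegral//.
  exact: integrable_norm.
by move=> x _; rewrite (le_trans (normr_Im_le _)).
Qed.

Lemma ae_eq_Cintegral f g : Cmeasurable setT f -> Cmeasurable setT g ->
  ae_eq mu setT f g -> Cintegral mu f = Cintegral mu g.
Proof.
move=> [f1 f2] [g1 g2] fg; congr Complex; congr fine; apply: ae_eq_integral => //;
  try exact/measurable_EFinP; by apply: filterS fg => x /[apply] ->.
Qed.

End complex_integrable.

Section complex_Fubini.
Context {R : realType} {d1 d2} {T1 : measurableType d1} {T2 : measurableType d2}.
Variables (m1 : {sigma_finite_measure set T1 -> \bar R})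
          (m2 : {sigma_finite_measure set T2 -> \bar R}).

Lemma Cmeasurable_Cintegral2 (F : T1 * T2 -> R[i]) :
  Cintegrable (m1 \x m2)%E F ->
  Cmeasurable setT (fun y => Cintegral m1 (fun x => F (x, y))).
Proof.
by move=> [F1 F2]; split => /=; apply: measurableT_comp => //;
  [exact: measurable_fubini_G F1|exact: measurable_fubini_G F2].
Qed.

(** Sections are required to be integrable at every point, not almost every one, so that all inner
    extended-real integrals are finite and [fineK] applies without an exceptional set. *)
Lemma Cintegral_Fubini (F : T1 * T2 -> R[i]) :
  Cintegrable (m1 \x m2)%E F ->
  (forall x, Cintegrable m2 (fun y => F (x, y))) ->
  (forall y, Cintegrable m1 (fun x => F (x, y))) ->
  Cintegral m1 (fun x => Cintegral m2 (fun y => F (x, y))) =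
  Cintegral m2 (fun y => Cintegral m1 (fun x => F (x, y))).
Proof.
move=> [F1 F2] s2 s1; congr Complex; congr fine.
  have := Fubini F1; congr (_ = _); apply: eq_integral => x _; rewrite fineK//.
    by apply: integrable_fin_num => //; case: (s2 x).
  by apply: integrable_fin_num => //; case: (s1 x).
have := Fubini F2; congr (_ = _); apply: eq_integral => x _; rewrite fineK//.
  by apply: integrable_fin_num => //; case: (s2 x).
by apply: integrable_fin_num => //; case: (s1 x).
Qed.

(** Tonelli: the dominating function is a tensor product, whose iterated integral factors into two
    finite ones. *)
Lemma Cintegrable_prod (F : T1 * T2 -> R[i]) (a : T1 -> R) (b : T2 -> R) :
  Cmeasurable setT F -> (forall x, 0 <= a x) -> (forall y, 0 <= b y) ->
  m1.-integrable setT (EFin \o a) -> m2.-integrable setT (EFin \o b) ->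
  (forall z, normc (F z) <= a z.1 * b z.2) -> Cintegrable (m1 \x m2)%E F.
Proof.
move=> mF a0 b0 ia ib Fab; apply: (le_Cintegrable mF _ Fab).
have ma := measurable_int _ ia; have mb := measurable_int _ ib.
apply/integrable12ltyP.
  apply/measurable_EFinP; apply: measurable_funM; apply: measurableT_comp => //.
    exact/measurable_EFinP.
  exact/measurable_EFinP.
under eq_integral => x _.
  under eq_integral => y _ do rewrite /= normrM (ger0_norm (a0 _)) (ger0_norm (b0 _)) EFinM.
  rewrite ge0_integralZl//; [|by move=> y _; rewrite lee_fin|by rewrite lee_fin].
  over.
have ibf : (\int[m2]_y (b y)%:E \is a fin_num)%E by apply: integrable_fin_num.
rewrite -(fineK ibf) ge0_integralZr//; last 2 first.
  by move=> x _; rewrite lee_fin.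
  by rewrite lee_fin fine_ge0// integral_ge0// => y _; rewrite lee_fin.
rewrite lte_mul_pinfty//.
- by apply: integral_ge0 => x _; rewrite lee_fin.
- by apply: integrable_fin_num.
- by rewrite fineK// -ge0_fin_numE// integral_ge0// => y _; rewrite lee_fin.
Qed.

End complex_Fubini.

(** * Sums over countable families *)

Section nonnegative_families.
Context {R : realType} {T : choiceType}.
Implicit Types (a b : T -> R) (s : seq T).

Lemma sum_le_esum (a : T -> \bar R) s : uniq s ->
  (\sum_(t <- s) a t <= \esum_(t in setT) a t)%E.
Proof.
move=> us; apply: esum_ge; exists [set` s]; last by rewrite -fsbig_seq.
by split=> //; exact: finite_seq.
Qed.

Lemma esum_leP (a : T -> \bar R) (x : \bar R) :
  (forall s, uniq s -> (\sum_(t <- s) a t <= x)%E) ->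
  (\esum_(t in setT) a t <= x)%E.
Proof.
move=> H; apply: ge_ereal_sup => _ [A [finA _] <-].
by rewrite fsbig_finite//; apply: H; exact: fset_uniq.
Qed.

(** One inequality, [H], used for [c] and for its inverse, gives both directions; [c = 0] relies on
    the convention that 0 times infinity is 0. *)
Lemma esumZ (c : R) a : 0 <= c -> (forall t, 0 <= a t) ->
  (\esum_(t in setT) (c * a t)%:E = c%:E * \esum_(t in setT) (a t)%:E)%E.
Proof.
have H (k : R) b : 0 <= k ->
    (\esum_(t in setT) (k * b t)%:E <= k%:E * \esum_(t in setT) (b t)%:E)%E.
  move=> k0; apply: esum_leP => s us.
  under eq_bigr do rewrite EFinM.
  rewrite sumEFin -mulr_sumr EFinM -sumEFin lee_wpmul2l ?lee_fin//.
  exact: sum_le_esum.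
move=> c0 a0; apply/eqP; rewrite eq_le; apply/andP; split; first exact: H.
have [->|cn0] := eqVneq c 0.
  by rewrite mul0e; apply: esum_ge0 => t _; rewrite mul0r.
have cp : 0 < c by rewrite lt_def cn0.
rewrite -lee_pdivlMl//.
have := H c^-1 (fun t => c * a t); rewrite invr_ge0 => /(_ c0).
by apply: le_trans; apply: le_esum => t _; rewrite mulKf.
Qed.

End nonnegative_families.

(** * Signed and complex absolutely convergent sums *)

Section rsum.
Context {R : realType} {T : choiceType}.
Implicit Types (a b u v : T -> R).

Definition rsummable a : Prop := summable setT (EFin \o a).

Lemma rsummable_esum a : (forall t, 0 <= a t) -> rsummable a ->
  \esum_(t in setT) (a t)%:E \is a fin_num.
Proof.
move=> a0; rewrite /rsummable summableE; congr (_ \is a fin_num).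
by apply: eq_esum => t _ /=; rewrite ger0_norm.
Qed.

Lemma le_rsummable a b : (forall t, `|a t| <= b t) -> rsummable b -> rsummable a.
Proof.
move=> ab; apply: le_lt_trans; apply: le_esum => t _ /=.
by rewrite lee_fin (le_trans (ab t))// ler_norm.
Qed.

Lemma rsummable_pos a : rsummable a -> rsummable (fun t => Num.max (a t) 0).
Proof.
move=> sa; apply: (@le_rsummable _ (fun t => `|a t|)) => [t|].
  by rewrite ger0_norm ?le_max ?lexx ?orbT// ge_max normr_ge0 ler_norm.
apply: le_lt_trans sa; apply: le_esum => t _ /=.
by rewrite normr_id.
Qed.

Lemma rsummableN a : rsummable a -> rsummable (fun t => - a t).
Proof.
by apply: le_lt_trans; apply: le_esum => t _ /=; rewrite normrN.
Qed.

Lemma rsummableD a b : rsummable a -> rsummable b ->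
  rsummable (fun t => a t + b t).
Proof. by move=> sa sb; exact: (summableD sa sb). Qed.

(** The positive part p and negative part q of u - v satisfy p + v = u + q termwise, so any
    splitting into summable nonnegative families computes [rsum]. This gives additivity, where the
    natural splitting is not the canonical one. *)
Lemma rsum_sub u v : (forall t, 0 <= u t) -> (forall t, 0 <= v t) ->
  rsummable u -> rsummable v ->
  rsum (fun t => u t - v t) =
  fine (\esum_(t in setT) (u t)%:E) - fine (\esum_(t in setT) (v t)%:E).
Proof.
move=> u0 v0 su sv; pose a t := u t - v t.
have sa : rsummable a by apply: rsummableD => //; exact: rsummableN.
pose p t := Num.max (a t) 0; pose q t := Num.max (- a t) 0.
have p0 t : 0 <= p t by rewrite le_max lexx orbT.
have q0 t : 0 <= q t by rewrite le_max lexx orbT.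
have sp : rsummable p by exact: rsummable_pos.
have sq : rsummable q by apply: rsummable_pos; exact: rsummableN.
have E : (\esum_(t in setT) (p t)%:E + \esum_(t in setT) (v t)%:E =
          \esum_(t in setT) (u t)%:E + \esum_(t in setT) (q t)%:E)%E.
  rewrite -!esumD; try by move=> t _; rewrite lee_fin.
  apply: eq_esum => t _; rewrite -!EFinD; congr EFin.
  rewrite /p /q /a maxEle maxEle oppr_le0; case: lerP => h.
    by case: lerP => h'; lra.
  by case: lerP => h'; lra.
move: E => /(congr1 fine); rewrite !fineD; try exact: rsummable_esum.
rewrite /rsum -/a -/p -/q => E.
by apply/eqP; rewrite subr_eq addrAC eq_sym subr_eq -E.
Qed.

Lemma max_subE (x : R) : x = Num.max x 0 - Num.max (- x) 0.
Proof. by rewrite !maxEle oppr_le0; do 2 case: lerP => ?; lra. Qed.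

Lemma rsumD a b : rsummable a -> rsummable b ->
  rsum (fun t => a t + b t) = rsum a + rsum b.
Proof.
move=> sa sb.
have p0 c t : 0 <= Num.max (c t) (0 : R) by rewrite le_max lexx orbT.
have -> : (fun t => a t + b t) = (fun t => (Num.max (a t) 0 + Num.max (b t) 0)
                               - (Num.max (- a t) 0 + Num.max (- b t) 0)).
  by apply/funext => t; rewrite opprD addrACA -!max_subE.
have sa' := rsummableN sa; have sb' := rsummableN sb.
rewrite rsum_sub; last 4 first.
- by move=> t; rewrite addr_ge0.
- by move=> t; rewrite addr_ge0// le_max lexx orbT.
- by apply: rsummableD; exact: rsummable_pos.
- by apply: rsummableD; exact: rsummable_pos.
under eq_esum do rewrite EFinD.
rewrite esumD; try by move=> t _; rewrite lee_fin.
under [in X in _ - X]eq_esum do rewrite EFinD.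
rewrite esumD; try by move=> t _; rewrite lee_fin le_max lexx orbT.
rewrite !fineD ?/rsum; first by rewrite opprD addrACA.
all: by apply: rsummable_esum => [t|]; [rewrite le_max lexx orbT|exact: rsummable_pos].
Qed.

Lemma rsumN a : rsum (fun t => - a t) = - rsum a.
Proof. by rewrite /rsum opprB; under [in X in _ - X]eq_esum do rewrite opprK. Qed.

Lemma rsummableZ (c : R) a : rsummable a -> rsummable (fun t => c * a t).
Proof.
move=> sa; rewrite /rsummable /summable.
have -> : (\esum_(t in setT) `|(EFin \o (fun t => (c * a t)%R)) t| =
          `|c|%:E * \esum_(t in setT) (`|a t|)%:E)%E.
  by rewrite -esumZ//; apply: eq_esum => t _ /=; rewrite normrM.
by rewrite lte_mul_pinfty// ?lee_fin//; apply: esum_ge0 => t _; rewrite lee_fin.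
Qed.

Lemma rsumZ (c : R) a : rsummable a -> rsum (fun t => c * a t) = c * rsum a.
Proof.
move=> sa.
have p0 b t : 0 <= Num.max (b t) (0 : R) by rewrite le_max lexx orbT.
have H (k : R) : 0 <= k -> rsum (fun t => k * a t) = k * rsum a.
  move=> k0.
  have F u : rsummable u ->
      fine (\esum_(t in setT) (Num.max (k * u t) 0)%:E) =
      k * fine (\esum_(t in setT) (Num.max (u t) 0)%:E).
    move=> su; rewrite -[X in X * fine _]/(fine k%:E) -fineM//; last first.
      by apply: rsummable_esum => [t|]; [exact: p0|exact: rsummable_pos].
    rewrite -esumZ//; congr fine; apply: eq_esum => t _.
    by rewrite maxr_pMr// mulr0.
  rewrite /rsum mulrBr F//; congr (_ - _).
  rewrite -(F (fun t => - a t)); last exact: rsummableN.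
  by congr fine; apply: eq_esum => t _; rewrite mulrN.
have [/H//|c0] := leP 0 c.
rewrite -[LHS]opprK -rsumN; under [in X in rsum X]eq_fun do rewrite -mulNr.
by rewrite H ?oppr_ge0 ?ltW// mulNr opprK.
Qed.

End rsum.

Section Csum.
Context {R : realType} {T : choiceType}.
Implicit Types (a : T -> R[i]).

Lemma Csummable_Re a : Csummable a -> rsummable (fun t => Re (a t)).
Proof. by apply: le_rsummable => t; exact: normr_Re_le. Qed.

Lemma Csummable_Im a : Csummable a -> rsummable (fun t => Im (a t)).
Proof. by apply: le_rsummable => t; exact: normr_Im_le. Qed.

Lemma CsumZr a (z : R[i]) : Csummable a -> Csum (fun t => a t * z) = Csum a * z.
Proof.
move=> sa; have s1 := Csummable_Re sa; have s2 := Csummable_Im sa.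
apply: eqC; rewrite ?ReM ?ImM /=.
  have -> : (fun t => Re (a t * z)) =
            (fun t => Re z * Re (a t) + (- Im z) * Im (a t)).
    by apply/funext => t; rewrite ReM mulNr mulrC [Im z * _]mulrC.
  rewrite rsumD; [|exact: rsummableZ|exact: rsummableZ].
  by rewrite !rsumZ// mulNr mulrC [Im z * _]mulrC.
have -> : (fun t => Im (a t * z)) =
          (fun t => Im z * Re (a t) + Re z * Im (a t)).
  by apply/funext => t; rewrite ImM mulrC [Re z * _]mulrC.
rewrite rsumD; [|exact: rsummableZ|exact: rsummableZ].
by rewrite !rsumZ// mulrC [Re z * _]mulrC.
Qed.

Lemma esum_single (b : T -> \bar R) t0 : (0 <= b t0)%E ->
  (forall t, t <> t0 -> b t = 0%E) -> \esum_(t in setT) b t = b t0.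
Proof.
move=> b0 H; rewrite -[RHS](esum_set1 b0) [RHS]esum_mkcond.
apply: eq_esum => t _; case: ifPn => //; rewrite notin_setE => /= h.
by rewrite H.
Qed.

Lemma Csum_single a t0 : (forall t, t <> t0 -> a t = 0) -> Csum a = a t0.
Proof.
move=> H.
have S (b : T -> R) : (forall t, t <> t0 -> b t = 0) -> rsum b = b t0.
  move=> Hb; rewrite /rsum (@esum_single _ t0); last 2 first.
  - by rewrite lee_fin le_max lexx orbT.
  - by move=> t /Hb ->; rewrite maxxx.
  rewrite (@esum_single _ t0); last 2 first.
  - by rewrite lee_fin le_max lexx orbT.
  - by move=> t /Hb ->; rewrite oppr0 maxxx.
  by rewrite -max_subE.
by apply: eqC => /=; apply: S => t /H ->.
Qed.

(* [fine] sends an infinite sum to [0]. *)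
Lemma Csum_divergent (a : T -> R) : (forall t, 0 <= a t) ->
  ~ rsummable a -> Csum (fun t => (a t)%:C%C) = 0.
Proof.
move=> a0 na.
have oo : \esum_(t in setT) (Num.max (a t) 0)%:E = +oo%E.
  apply/eqP; rewrite -leye_eq leNgt; apply/negP => h; apply: na.
  by apply: le_lt_trans h; apply: le_esum => t _ /=; rewrite ger0_norm// max_l.
apply: eqC; rewrite /= /rsum.
  rewrite oo /= esum1 ?subrr// => t _.
  by rewrite max_r// oppr_le0.
by rewrite !esum1 ?subrr// => t _; rewrite ?oppr0 maxxx.
Qed.

End Csum.

(** An index j with |j| <= n occurs n + 1 - |j| times as k - l, so this is the Cesaro mean of the
    symmetric partial sums. The double sum is kept because for exponentials it factors as z times
    its conjugate. The field is a parameter to serve real and complex sequences alike. *)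
Definition fejer_mean {K : fieldType} (a : int -> K) (n : nat) : K :=
  n.+1%:R^-1 * \sum_(k < n.+1) \sum_(l < n.+1) a (k%:Z - l%:Z).

Section Fejer_means.
Context {R : realType}.

(** Row k sums b over the window of all k - l, so it never exceeds the total. A finite set of
    indices bounded by J that nearly exhausts the total lies in the window of every row with J <= k
    < n + 1 - J; only 2J rows are lost. *)
Lemma cvg_fejer_mean_ge0 (b : int -> R) : (forall j, 0 <= b j) -> rsummable b ->
  fejer_mean b n @[n --> \oo] --> fine (\esum_(j in setT) (b j)%:E).
Proof.
move=> b0 sb; have finS := rsummable_esum b0 sb.
set S := \esum_(j in _) _ in finS *.
have seqle (s : seq int) : uniq s -> \sum_(j <- s) b j <= fine S.
  by move=> us; rewrite -lee_fin fineK// -sumEFin; exact: sum_le_esum.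
have S0 : 0 <= fine S by have := seqle [::] isT; rewrite big_nil.
have row (n : nat) (k : int) : \sum_(l < n.+1) b (k - l%:Z) <= fine S.
  rewrite -(big_map (fun l : 'I_n.+1 => k - l%:Z) xpredT b); apply: seqle.
  rewrite map_inj_uniq ?index_enum_uniq// => i j /addrI/oppr_inj[]; exact: val_inj.
have up n : fejer_mean b n <= fine S.
  rewrite /fejer_mean ler_pdivrMl// mulr_natl.
  rewrite -[in leRHS](card_ord n.+1) -sumr_const; apply: ler_sum => k _; exact: row.
have low (e : R) : 0 < e -> exists (J : nat) (X : R), [/\ 0 <= X, fine S - e <= X &
    forall n, (n.+1%:R - 2 * J%:R) * X <= n.+1%:R * fejer_mean b n].
  move=> e0; have [_ [A [finA _] <-]] := ub_ereal_sup_adherent e0 finS.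
  rewrite fsbig_finite// -/S; set s : seq int := fset_set A; rewrite sumEFin => SX.
  pose J := (\max_(j <- s) `|j|)%N; exists J, (\sum_(j <- s) b j); split.
  - by apply: sumr_ge0.
  - by rewrite -lee_fin EFinB fineK// ltW.
  move=> n; rewrite /fejer_mean mulVKf ?pnatr_eq0//.
  (* With fewer than 2J rows the left side is nonpositive and the bound is trivial. *)
  have [nJ|nJ] := ltP n.+1%:R (2 * J%:R : R).
    rewrite (@le_trans _ _ 0)//; last by apply: sumr_ge0 => k _; apply: sumr_ge0.
    by apply: mulr_le0_ge0; [rewrite subr_le0 ltW|exact: sumr_ge0].
  have nJ' : (2 * J <= n.+1)%N by rewrite -(ler_nat R) natrM.
  have us : uniq s by exact: fset_uniq.
  have rowlow (k : nat) : (J <= k < n.+1 - J)%N ->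
      \sum_(j <- s) b j <= \sum_(l < n.+1) b (k%:Z - l%:Z).
    move=> kJ; rewrite -(big_map (fun l : 'I_n.+1 => k%:Z - l%:Z) xpredT b).
    set t := map _ _.
    have ut : uniq t.
      rewrite map_inj_uniq ?index_enum_uniq// => i j /addrI/oppr_inj[]; exact: val_inj.
    rewrite (bigID (mem s) xpredT)/= [leRHS](bigID (mem s) xpredT)/=.
    rewrite [X in _ + X <= _]big_seq_cond [X in _ + X <= _]big1 ?addr0; last first.
      by move=> j /andP[->].
    rewrite -[X in X <= _]addr0 lerD ?sumr_ge0//.
    rewrite -big_filter -[leRHS]big_filter.
    rewrite (@perm_big _ _ _ _ _ [seq j <- t | j \in s])//.
    apply: uniq_perm; rewrite ?filter_uniq// => j; rewrite !mem_filter andbC.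
    case js : (j \in s) => //=; apply/esym/mapP.
    have jJ : (`|j| <= J)%N by rewrite /J (big_rem j)//= leq_maxl.
    have jn : (`|(k%:Z - j)| < n.+1)%N by lia.
    (* The column is l = k - j, which lies between 0 and n because |j| <= J <= k < n + 1 - J; the
       absolute value only converts it to a natural number. *)
    by exists (Ordinal jn); [rewrite mem_index_enum|rewrite /=; lia].
  rewrite -(big_mkord xpredT (fun k => \sum_(l < n.+1) b (k%:Z - l%:Z))).
  rewrite (@big_cat_nat _ _ _ J)//=; last by lia.
  rewrite (@big_cat_nat _ _ _ (n.+1 - J)%N J n.+1)//=; [|by lia|by lia].
  rewrite -[leLHS]add0r lerD//; first by apply: sumr_ge0 => k _; apply: sumr_ge0.
  rewrite -[leLHS]addr0 lerD//; last by apply: sumr_ge0 => k _; apply: sumr_ge0.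
  have -> : n.+1%:R - 2 * J%:R = (n.+1 - J - J)%:R :> R.
    by rewrite -subnDA addnn -mul2n natrB// natrM.
  by rewrite mulr_natl -sumr_const_nat; exact: ler_sum_nat.
apply/cvgrPdist_le => e e0.
have [J [X [X0 SX H]]] := low _ (divr_gt0 e0 (ltr0Sn R 1)).
near=> n.
rewrite ger0_norm ?subr_ge0//.
have := H n; have n0 : 0 < n.+1%:R :> R by [].
(* Half of e pays for the lost rows once n is large; the other half was spent on the choice of the
   finite set. *)
have Sn : 2 * J%:R * X <= n.+1%:R * (e / 2).
  near: n; exists (Num.truncn (2 * J%:R * X / (e / 2))) => // m /= Hm.
  rewrite -ler_pdivrMr ?divr_gt0//.
  by rewrite (le_trans (ltW (truncnS_gt _)))// ler_nat ltnS.
move: Sn; set F := fejer_mean b n => Sn HH.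
have : n.+1%:R * (X - e / 2) <= n.+1%:R * F by lra.
rewrite ler_pM2l//; lra.
Unshelve. all: by end_near.
Qed.

Lemma cvg_fejer_mean (a : int -> R) : rsummable a ->
  fejer_mean a n @[n --> \oo] --> rsum a.
Proof.
move=> sa; pose p j := Num.max (a j) 0; pose q j := Num.max (- a j) 0.
have -> : fejer_mean a = fun n => fejer_mean p n - fejer_mean q n.
  apply/funext => n; rewrite /fejer_mean -mulrBr -sumrB; congr (_ * _).
  apply: eq_bigr => k _; rewrite -sumrB; apply: eq_bigr => l _.
  exact: max_subE.
apply: cvgB; apply: cvg_fejer_mean_ge0.
- by move=> j; rewrite le_max lexx orbT.
- exact: rsummable_pos.
- by move=> j; rewrite le_max lexx orbT.
- exact/rsummable_pos/rsummableN.
Qed.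

End Fejer_means.

(** * The circle and the Fejer kernel *)

Section circle_integrals.
Variable R : realType.
Local Notation mR := (measurableTypeR R).
Local Notation circ := (@circle_measure R).
Local Notation leb := (@lebesgue_measure R).

Lemma circle_measureT : circ setT = 1%E.
Proof.
have pi0 := pi_gt0 R.
rewrite /circle_measure /mscale/= /mrestr setTI lebesgue_measure_itv/=.
rewrite lte_fin mulr_gt0// oppr0 adde0 -EFinM mulVf//.
by rewrite mulf_neq0 ?gt_eqF.
Qed.

HB.instance Definition _ := @Measure_isProbability.Build _ _ _
  circ circle_measureT.

Lemma circle_integrable (h : mR -> R) (M : R) : measurable_fun setT h ->
  (forall x, `|h x| <= M) -> circ.-integrable setT (EFin \o h).
Proof.
move=> mh hM; apply: measurable_bounded_integrable => //.
  by rewrite [X in (X < _)%E]circle_measureT ltry.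
exists M; split; first exact: num_real.
by move=> N MN x _; exact: le_trans (hM x) (ltW MN).
Qed.

Lemma circle_Cintegrable (h : mR -> R[i]) (M : R) : Cmeasurable setT h ->
  (forall x, normc (h x) <= M) -> Cintegrable circ h.
Proof.
move=> mh hM; apply: (@le_Cintegrable _ _ _ _ _ (fun=> M)) => //.
by apply: (@circle_integrable _ `|M|).
Qed.

Lemma circle_integral_ge0 (h : R -> R) : continuous h -> (forall x, 0 <= h x) ->
  (\int[circ]_x (h x)%:E =
   ((2 * pi)^-1)%:E * \int[leb]_(x in `[0%R, (2 * pi)%R]) (h x)%:E)%E.
Proof.
move=> ch h0; have mh : measurable_fun setT (EFin \o h : mR -> \bar R).
  by apply/measurable_EFinP; exact: continuous_measurable_fun.
rewrite ge0_integral_mscale//; last by move=> x _; rewrite lee_fin.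
congr (_ * _)%E; set D : set mR := `[0, 2 * pi[%classic.
have mD : measurable D by exact: measurable_itv.
rewrite (@ge0_negligible_integral _ _ _ _ setT (~` D))//=; last 3 first.
- exact: measurableC.
- by move=> x _; rewrite lee_fin.
- by rewrite /mrestr setICl measure0.
rewrite setTD setCK (@eq_measure_integral _ _ _ _ leb).
  by rewrite integral_itv_bndo_bndc//; apply: measurable_funS mh.
by move=> A mA AD; rewrite /= /mrestr; congr leb; exact/setIidl.
Qed.

(** Nonnegativity comes from the rules for scaled and restricted measures behind
    [circle_integral_ge0]; signed integrands are shifted by a constant before use. *)
Lemma circle_FTC (h F : R -> R) : continuous h -> (forall x, 0 <= h x) ->
  (forall x, is_derive x (1 : R) F (h x)) ->
  \int[circ]_x h x = (2 * pi)^-1 * (F (2 * pi) - F 0).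
Proof.
move=> ch h0 dF; rewrite /Rintegral circle_integral_ge0//.
have cF : continuous F.
  by move=> x; apply: differentiable_continuous; apply/derivable1_diffP; case: (dF x).
rewrite (@continuous_FTC2 _ h F) ?mulr_gt0 ?pi_gt0//.
- exact: continuous_subspaceT.
- split.
  + by move=> x _; case: (dF x).
  + by apply: cvg_at_right_filter; exact: cF.
  + by apply: cvg_at_left_filter; exact: cF.
- by move=> x _; rewrite derive1E derive_val.
Qed.

Lemma Cintegral_expi_int (j : int) :
  Cintegral circ (fun x => expi (j%:~R * x)) = (j == 0)%:R.
Proof.
have m1 : \int[circ]_x (1 : R) = 1.
  by rewrite Rintegral_cst// mul1r [X in fine X]circle_measureT.
have [->|j0] := eqVneq j 0.
  apply: eqC => /=; under eq_Rintegral do rewrite mul0r ?cos0 ?sin0.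
    by rewrite m1.
  by rewrite Rintegral_cst// mul0r.
set J : R := j%:~R; have J0 : J != 0 by rewrite intr_eq0.
have cJ : continuous (fun x : R => J * x).
  by move=> x; apply: cvgM; [exact: cvg_cst|exact: cvg_id].
have ccos : continuous (fun x : R => cos (J * x)).
  by move=> x; apply: continuous_comp; [exact: cJ|exact: continuous_cos].
have csin : continuous (fun x : R => sin (J * x)).
  by move=> x; apply: continuous_comp; [exact: cJ|exact: continuous_sin].
have per := @expi_period R 0 j; rewrite add0r mulrC expi0 in per.
(* For the cosine and the sine, 1 + h is nonnegative, so [circle_FTC] applies to it; the integral of
   1 is then cancelled. *)
have iB (h : mR -> R) : continuous (h : R -> R) -> (forall x, `|h x| <= 1) ->
    \int[circ]_x (1 + h x) = 1 + \int[circ]_x h x.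
  move=> ch h1; rewrite RintegralD ?m1//.
    by apply: (@circle_integrable _ 1) => // x; rewrite normr1.
  by apply: (@circle_integrable _ 1) => //; exact: continuous_measurable_fun.
have twopi0 : 2 * pi != 0 :> R by rewrite mulf_neq0 ?gt_eqF ?pi_gt0.
have [pc ps] : cos (J * (2 * pi)) = 1 /\ sin (J * (2 * pi)) = 0.
  by move: per => [+ +]; rewrite mulrC.
have dJ (x : R) : is_derive x (1 : R) (J *: (@id R)) J.
  by apply: (is_derive_eq (is_deriveZ J (is_derive_id x (1 : R)))); rewrite /GRing.scale /= mulr1.
have Ic : \int[circ]_x cos (J * x) = 0.
  apply: (@addrI _ 1); rewrite addr0 -iB//; last first.
    by move=> x; rewrite ler_norml cos_geN1 cos_le1.
  pose F : R -> R := @id R + J^-1 *: (@sin R \o (J *: (@id R))).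
  have dF (x : R) : is_derive x (1 : R) F (1 + cos (J * x)).
    have d1 := @is_derive1_comp _ (@sin R) _ x _ _ (is_derive_sin _) (dJ x).
    have d2 := is_deriveD (is_derive_id x (1 : R)) (is_deriveZ J^-1 d1).
    apply: (is_derive_eq d2).
    by rewrite /GRing.scale /= mulrCA mulVf// mulr1.
  have c1 : continuous (fun x : R => 1 + cos (J * x)).
    by move=> x; apply: cvgD; [exact: cvg_cst|exact: ccos].
  have c2 (x : R) : 0 <= 1 + cos (J * x) by have := cos_geN1 (J * x); lra.
  rewrite (circle_FTC c1 c2 dF).
  have -> : F (2 * pi) = 2 * pi + J^-1 * sin (J * (2 * pi)) by [].
  have -> : F 0 = 0 + J^-1 * sin (J * 0) by [].
  by rewrite ps !mulr0 sin0 mulr0 !addr0 subr0 mulVf.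
have Is : \int[circ]_x sin (J * x) = 0.
  apply: (@addrI _ 1); rewrite addr0 -iB//; last first.
    by move=> x; rewrite ler_norml sin_geN1 sin_le1.
  pose F : R -> R := @id R + (- J^-1) *: (@cos R \o (J *: (@id R))).
  have dF (x : R) : is_derive x (1 : R) F (1 + sin (J * x)).
    have d1 := @is_derive1_comp _ (@cos R) _ x _ _ (is_derive_cos _) (dJ x).
    have d2 := is_deriveD (is_derive_id x (1 : R)) (is_deriveZ (- J^-1) d1).
    apply: (is_derive_eq d2).
    by rewrite /GRing.scale /= !mulNr mulrN opprK mulrCA mulVf// mulr1.
  have c1 : continuous (fun x : R => 1 + sin (J * x)).
    by move=> x; apply: cvgD; [exact: cvg_cst|exact: csin].
  have c2 (x : R) : 0 <= 1 + sin (J * x) by have := sin_geN1 (J * x); lra.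
  rewrite (circle_FTC c1 c2 dF).
  have -> : F (2 * pi) = 2 * pi + (- J^-1) * cos (J * (2 * pi)) by [].
  have -> : F 0 = 0 + (- J^-1) * cos (J * 0) by [].
  by rewrite pc mulr0 cos0 mulr1 add0r opprK subrK mulVf.
by apply: eqC.
Qed.

(** The shift factors out as a constant phase, which is 1 for j = 0 and multiplies zero otherwise;
    no translation invariance of the angular measure on a half-open interval is involved. *)
Lemma Cintegral_expi_int_shift (j : int) (c : R) :
  Cintegral circ (fun x => expi (j%:~R * (x + c))) = (j == 0)%:R.
Proof.
under eq_fun do rewrite mulrDr expiD mulrC.
rewrite CintegralZ.
  rewrite Cintegral_expi_int; case: eqP => [->|_]; last by rewrite mulr0.
  by rewrite mul0r expi0 mulr1.
apply: (@circle_Cintegrable _ 1); last by move=> x; rewrite normc_expi.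
apply: Cmeasurable_expi; exact: measurable_funM.
Qed.


(** The Fejer kernel written as a squared modulus: nonnegativity is immediate, and unlike in the
    quotient of sines no point is singular. *)
Definition fejer_kernel (n : nat) (s : R) : R :=
  n.+1%:R^-1 * normc (\sum_(k < n.+1) expi (k%:R * s)) ^+ 2.

Lemma fejer_kernel_ge0 n s : 0 <= fejer_kernel n s.
Proof. by rewrite mulr_ge0 ?invr_ge0 ?exprn_ge0 ?normc_ge0. Qed.

Lemma fejer_kernelE n s :
  fejer_mean (fun j => expi (j%:~R * s)) n = (fejer_kernel n s)%:C%C.
Proof.
rewrite /fejer_mean /fejer_kernel; set z := \sum_(k < n.+1) expi (k%:R * s).
have zz : (normc z ^+ 2)%:C%C = z * conjc z.
  apply: eqC; rewrite ?ReM ?ImM Re_conjc Im_conjc normcE /=.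
    by rewrite sqr_sqrtr ?addr_ge0 ?sqr_ge0// mulrN opprK.
  by rewrite mulrN mulrC addNr.
have -> : (n.+1%:R^-1 * normc z ^+ 2)%:C%C = n.+1%:R^-1 * (z * conjc z).
  by rewrite -zz -(rmorph_nat (real_complex R)) -fmorphV -rmorphM.
congr (_ * _).
have -> : conjc z = \sum_(l < n.+1) expi (- (l%:R * s)).
  by rewrite /z rmorph_sum; apply: eq_bigr => l _; exact/esym/expiN.
rewrite /z mulr_suml; apply: eq_bigr => k _.
rewrite mulr_sumr; apply: eq_bigr => l _.
by rewrite -expiD rmorphB /= mulrBl.
Qed.

Lemma measurable_fejer_kernel n (c : R) :
  measurable_fun setT (fun x : mR => fejer_kernel n (x + c)).
Proof.
apply: measurable_funM => //; apply: measurable_funX; apply: measurable_normc.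
split.
  under eq_fun do rewrite Re_sum; apply: measurable_sum => k.
  apply: (Cmeasurable_expi _).1; apply: measurable_funM => //.
  exact: measurable_funD.
under eq_fun do rewrite Im_sum; apply: measurable_sum => k.
apply: (Cmeasurable_expi _).2; apply: measurable_funM => //.
exact: measurable_funD.
Qed.

(** Used only for integrability at fixed n; uniform estimates rest on the mass instead. *)
Lemma fejer_kernel_le n s : fejer_kernel n s <= n.+1%:R.
Proof.
have S m : normc (\sum_(k < m) expi (k%:R * s)) <= m%:R.
  elim: m => [|m IH]; first by rewrite big_ord0 normcE /= expr0n addr0 sqrtr0.
  rewrite big_ord_recr/=; apply: le_trans (normc_leD _ _) _.
  by rewrite normc_expi -natr1 lerD2r.
rewrite /fejer_kernel ler_pdivrMl// -expr2 lerXn2r ?nnegrE ?normc_ge0//.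
Qed.

(** The finite average moves inside by linearity and the exponentials add up to the kernel, which
    concentrates where x + c vanishes modulo 2 pi. *)
Lemma fejer_mean_Cintegral (E : mR -> R[i]) (M c : R) n :
  Cmeasurable setT E -> (forall x, normc (E x) <= M) ->
  fejer_mean (fun j => Cintegral circ (fun x => E x * expi (j%:~R * (x + c)))) n
  = Cintegral circ (fun x => E x * (fejer_kernel n (x + c))%:C%C).
Proof.
move=> mE EM.
have mexp (j : int) : Cmeasurable setT (fun x : mR => expi (j%:~R * (x + c))).
  by apply: Cmeasurable_expi; apply: measurable_funM => //; exact: measurable_funD.
have iE (j : int) : Cintegrable circ (fun x => E x * expi (j%:~R * (x + c))).
  apply: (@circle_Cintegrable _ M); first exact: CmeasurableM.
  by move=> x; rewrite Normc.normcM normc_expi mulr1.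
under [in RHS]eq_fun do rewrite -fejer_kernelE /fejer_mean mulrCA mulr_sumr.
under [in RHS]eq_fun do under eq_bigr do rewrite mulr_sumr.
rewrite CintegralZ; last by do 2 (apply: Cintegrable_sum => ?).
rewrite Cintegral_sum; last by move=> k; apply: Cintegrable_sum.
congr (_ * _); apply: eq_bigr => k _.
by rewrite Cintegral_sum.
Qed.

Lemma Re_fejer_mean (a : int -> R[i]) n :
  Re (fejer_mean a n) = fejer_mean (fun j => Re (a j)) n.
Proof.
rewrite /fejer_mean -(rmorph_nat (real_complex R)) -fmorphV ReZ Re_sum.
by congr (_ * _); apply: eq_bigr => k _; rewrite Re_sum.
Qed.

Lemma Im_fejer_mean (a : int -> R[i]) n :
  Im (fejer_mean a n) = fejer_mean (fun j => Im (a j)) n.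
Proof.
rewrite /fejer_mean -(rmorph_nat (real_complex R)) -fmorphV ImZ Im_sum.
by congr (_ * _); apply: eq_bigr => k _; rewrite Im_sum.
Qed.

(** For E = 1 the only nonzero coefficient has index 0, and each of the n + 1 rows meets it once, at
    l = k. *)
Lemma fejer_kernel_mass n (c : R) : \int[circ]_x fejer_kernel n (x + c) = 1.
Proof.
have := @fejer_mean_Cintegral (fun=> 1) 1 c n (Cmeasurable_cst _ _).
have n1 : normc (1 : R[i]) = 1 by rewrite normcE /= expr1n expr0n addr0 sqrtr1.
rewrite n1 => /(_ (fun=> lexx 1)) /(congr1 (@Re R)).
under [in RHS]eq_fun do rewrite mul1r.
move=> /= <-; rewrite Re_fejer_mean.
under eq_fun do under eq_fun do rewrite mul1r.
under eq_fun do rewrite Cintegral_expi_int_shift.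
rewrite /fejer_mean (eq_bigr (fun=> 1)).
  by rewrite sumr_const card_ord mulVf.
move=> k _; rewrite (bigD1 k)//= subrr big1 ?addr0// => l lk.
rewrite subr_eq0; case: eqP => // -[kl]; exfalso; move/eqP: lk; apply.
by apply: val_inj.
Qed.

(** The function 1 - cos has the three coefficients 1, -1/2, -1/2, with sum 0, its value at the
    origin. The moments are the Fejer means of this summable sequence and so tend to its sum. *)
Lemma cvg_fejer_moment (c : R) :
  \int[circ]_x ((1 - cos (x + c)) * fejer_kernel n (x + c)) @[n --> \oo] --> (0 : R).
Proof.
pose d (i j : int) : R := (j == i)%:R.
pose a j : R := d 0 j + (- 2^-1) * d (-1) j + (- 2^-1) * d 1 j.
have sd i : rsummable (d i) /\ rsum (d i) = 1.
  have d0 j : 0 <= d i j by rewrite /d; case: eqP.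
  have sdi : \esum_(j in setT) (d i j)%:E = 1%E.
    rewrite (@esum_single _ _ _ i) /d ?eqxx// ?lee_fin// => j /eqP/negbTE ->.
    by [].
  split.
    rewrite /rsummable /summable (_ : \esum_(j in _) _ = 1%E) ?ltry//.
    by rewrite -sdi; apply: eq_esum => j _ /=; rewrite ger0_norm.
  rewrite /rsum.
  under eq_esum do rewrite max_l//.
  rewrite sdi esum1 ?subr0// => j _; rewrite max_r// oppr_le0//.
have sa : rsummable a /\ rsum a = 0.
  have [s0 r0] := sd 0; have [s1 r1] := sd 1; have [s2 r2] := sd (-1).
  split.
    by apply: rsummableD; [apply: rsummableD => //|]; exact: rsummableZ.
  rewrite rsumD; [|apply: rsummableD => //; exact: rsummableZ|exact: rsummableZ].
  rewrite rsumD//; last exact: rsummableZ.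
  by rewrite !rsumZ// r0 r1 r2; lra.
have [sa1 <-] := sa; have := cvg_fejer_mean sa1.
apply: cvg_trans; apply: near_eq_cvg; apply: nearW => n.
pose E (x : mR) : R[i] := (1 - cos (x + c))%:C%C.
have mE : Cmeasurable setT E.
  apply: Cmeasurable_real; apply: measurable_funB => //.
  apply: measurableT_comp; last exact: measurable_funD.
  by apply: continuous_measurable_fun; exact: continuous_cos.
have EM x : normc (E x) <= 2.
  rewrite normc_real ger0_norm.
    by have := cos_geN1 (x + c); lra.
  by have := cos_le1 (x + c); lra.
have := @fejer_mean_Cintegral E 2 c n mE EM => /(congr1 (@Re R)).
rewrite [X in _ = X -> _]/=.
under [in X in _ = X -> _]eq_Rintegral do rewrite mulr0 subr0.
move=> <-; rewrite Re_fejer_mean; congr (fejer_mean _ n); apply/funext => j.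
have iexp (i : int) : Cintegrable circ (fun x => expi (i%:~R * (x + c))).
  apply: (@circle_Cintegrable _ 1); last by move=> x; rewrite normc_expi.
  by apply: Cmeasurable_expi; apply: measurable_funM => //; exact: measurable_funD.
have -> : (fun x => E x * expi (j%:~R * (x + c))) =
   (fun x => (expi (j%:~R * (x + c)) + (- 2^-1)%:C%C * expi ((j + 1)%:~R * (x + c)))
             + (- 2^-1)%:C%C * expi ((j - 1)%:~R * (x + c))).
  apply/funext => x; rewrite /E; move: (x + c) => t.
  rewrite intrD intrB !mulrDl mulN1r mul1r !expiD expiN.
  case: (expi (j%:~R * t)) => u v.
  by apply: eqC; rewrite !(ReD, ReM, ImM, ImD, Re_conjc, Im_conjc) /=; field.
rewrite CintegralD; [|by apply: CintegrableD => //; exact: CintegrableZ|exact: CintegrableZ].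
rewrite CintegralD//; last exact: CintegrableZ.
rewrite !CintegralZ// !Cintegral_expi_int_shift !ReD !ReZ /a /d.
have E0 (b : bool) : Re (b%:R : R[i]) = b%:R by case: b.
by rewrite !E0 addr_eq0 subr_eq0.
Qed.

(** Weighted inequality of means, from (x - e)^2 >= 0. It replaces a first power by a square, for
    which the bound by 1 - cos is available. *)
Lemma normc_le_sqr (z : R[i]) (e : R) : 0 < e ->
  normc z <= e / 2 + (2 * e)^-1 * normc z ^+ 2.
Proof.
move=> e0; set x := normc z.
have : 0 <= (2 * e)^-1 * (x - e) ^+ 2.
  by rewrite mulr_ge0 ?sqr_ge0// invr_ge0 mulr_ge0// ltW.
have -> : (2 * e)^-1 * (x - e) ^+ 2 = (2 * e)^-1 * x ^+ 2 - x + e / 2.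
  by field; rewrite gt_eqF.
lra.
Qed.

(* Chebyshev: the second-moment bound on [E - z] turns the vanishing first
   moment of [1 - cos] against the Fejer kernel into convergence. *)
Lemma cvg_fejer_localization (E : mR -> R[i]) (z : R[i]) (M L c : R) :
  Cmeasurable setT E -> (forall x, normc (E x) <= M) ->
  (forall x, normc (E x - z) ^+ 2 <= L * (1 - cos (x + c))) ->
  let T n := fejer_mean
    (fun j => Cintegral circ (fun x => E x * expi (j%:~R * (x + c)))) n in
  [/\ forall n, normc (T n) <= 2 * M,
      Re (T n) @[n --> \oo] --> Re z &
      Im (T n) @[n --> \oo] --> Im z].
Proof.
move=> mE EM EL T.
have TE n : T n = Cintegral circ (fun x => E x * (fejer_kernel n (x + c))%:C%C).
  exact: fejer_mean_Cintegral mE EM.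
have mF n : measurable_fun setT (fun x : mR => fejer_kernel n (x + c)).
  exact: measurable_fejer_kernel.
have iF n : circ.-integrable setT (EFin \o (fun x => fejer_kernel n (x + c))).
  apply: (@circle_integrable _ n.+1%:R) => // x.
  by rewrite ger0_norm ?fejer_kernel_ge0 ?fejer_kernel_le.
have iFZ (k : R) n : circ.-integrable setT (EFin \o (fun x => k * fejer_kernel n (x + c))).
  exact: (@integrableZl _ _ _ circ setT measurableT k _ (iF n)).
have mcF n : Cmeasurable setT (fun x : mR => (fejer_kernel n (x + c))%:C%C).
  exact: Cmeasurable_real.
have normF n x : normc (fejer_kernel n (x + c))%:C%C = fejer_kernel n (x + c).
  by rewrite normc_real ger0_norm ?fejer_kernel_ge0.
have iEF (G : mR -> R[i]) (K : R) n : Cmeasurable setT G ->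
    (forall x, normc (G x) <= K) ->
    Cintegrable circ (fun x => G x * (fejer_kernel n (x + c))%:C%C).
  move=> mG GK; apply: (@circle_Cintegrable _ (K * n.+1%:R)).
    exact: CmeasurableM.
  move=> x; rewrite Normc.normcM normF ler_pM ?normc_ge0 ?fejer_kernel_ge0//.
  exact: fejer_kernel_le.
have bound n : normc (T n) <= 2 * M.
  rewrite TE; have := @normc_Cintegral_le _ _ _ circ _
    (fun x => M * fejer_kernel n (x + c)) (iEF E M n mE EM) (iFZ M n).
  rewrite RintegralZl// fejer_kernel_mass mulr1; apply => x.
  by rewrite Normc.normcM normF ler_wpM2r ?fejer_kernel_ge0.
pose G x := E x - z.
have mG : Cmeasurable setT G by apply: CmeasurableD => //; exact: Cmeasurable_cst.
have GM x : normc (G x) <= M + normc z.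
  by rewrite (le_trans (normc_leD _ _))// normc_opp lerD2r.
have TB n : T n - z = Cintegral circ (fun x => G x * (fejer_kernel n (x + c))%:C%C).
  rewrite TE /G; have -> : (fun x => (E x - z) * (fejer_kernel n (x + c))%:C%C) =
     (fun x => E x * (fejer_kernel n (x + c))%:C%C
               + (- z) * (fejer_kernel n (x + c))%:C%C).
    by apply/funext => x; rewrite mulrDl.
  have iF1 : Cintegrable circ (fun x => (fejer_kernel n (x + c))%:C%C).
    have := iEF (fun=> 1) (normc 1) n (Cmeasurable_cst _ _) (fun=> lexx _).
    by under eq_fun do rewrite mul1r.
  rewrite CintegralD; [|exact: iEF mE EM|exact: CintegrableZ].
  rewrite CintegralZ//; congr (_ + _).
  have -> : Cintegral circ (fun x => (fejer_kernel n (x + c))%:C%C) = 1.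
    apply: eqC => /=; first exact: fejer_kernel_mass.
    by rewrite Rintegral_cst// mul0r.
  by rewrite mulr1.
have iM n : circ.-integrable setT
    (EFin \o (fun x => (1 - cos (x + c)) * fejer_kernel n (x + c))).
  apply: (@circle_integrable _ (2 * n.+1%:R)).
    apply: measurable_funM => //; apply: measurable_funB => //.
    apply: measurableT_comp; last exact: measurable_funD.
    by apply: continuous_measurable_fun; exact: continuous_cos.
  move=> x; rewrite normrM ler_pM//.
    by rewrite ler_norml; have := cos_le1 (x + c); have := cos_geN1 (x + c); lra.
  by rewrite ger0_norm ?fejer_kernel_ge0 ?fejer_kernel_le.
(* Integrating [normc_le_sqr] against the kernel gives e/2 plus |L|/(2e) times the moment; the
   factor 2 of [normc_Cintegral_le] doubles both. The absolute value appears because the sign of [L]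
   is not assumed. *)
have dist (e : R) n : 0 < e -> normc (T n - z) <=
    e + `|L| / e * \int[circ]_x ((1 - cos (x + c)) * fejer_kernel n (x + c)).
  move=> e0; rewrite TB.
  pose h x := (e / 2) * fejer_kernel n (x + c)
      + (2 * e)^-1 * `|L| * ((1 - cos (x + c)) * fejer_kernel n (x + c)).
  have iM' : circ.-integrable setT (EFin \o (fun x => (2 * e)^-1 * `|L| *
      ((1 - cos (x + c)) * fejer_kernel n (x + c)))).
    exact: (@integrableZl _ _ _ circ setT measurableT ((2 * e)^-1 * `|L|) _ (iM n)).
  have ih : circ.-integrable setT (EFin \o h).
    by apply: (integrableD measurableT (iFZ (e / 2) n) iM').
  have := normc_Cintegral_le (iEF _ _ n mG GM) ih.
  have I1 : \int[circ]_x (e / 2 * fejer_kernel n (x + c)) = e / 2.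
    by rewrite RintegralZl// fejer_kernel_mass mulr1.
  rewrite /h RintegralD// I1 RintegralZl// => H.
  apply: (le_trans (H _)) => [x|].
    rewrite [X in _ <= _ + X]mulrA -mulrDl Normc.normcM normF ler_wpM2r ?fejer_kernel_ge0//.
    rewrite (le_trans (normc_le_sqr _ e0))// lerD2l -mulrA ler_wpM2l//.
      by rewrite invr_ge0 mulr_ge0// ltW.
    by rewrite (le_trans (EL x))// ler_wpM2r ?ler_norm// subr_ge0 cos_le1.
  rewrite le_eqVlt; apply/orP; left; apply/eqP; field.
  by rewrite gt_eqF.
(* The parameter of [dist] is fixed at e/2 first; then n is taken large enough for the moment term
   to fall below e/2. *)
have lim : normc (T n - z) @[n --> \oo] --> (0 : R).
  apply/cvgrPdist_le => e e0.
  have e20 : 0 < e / 2 by rewrite divr_gt0.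
  have H0 : (`|L| / (e / 2)) * \int[circ]_x ((1 - cos (x + c)) *
      fejer_kernel n (x + c)) @[n --> \oo] --> `|L| / (e / 2) * 0.
    by apply: cvgM; [exact: cvg_cst|exact: cvg_fejer_moment].
  move: H0.
  rewrite mulr0 => /cvgrPdist_le/(_ _ e20); apply: filterS => n.
  rewrite !sub0r !normrN (ger0_norm (normc_ge0 _)) => H.
  rewrite (le_trans (dist _ n e20))// [leRHS](splitr e) lerD2l.
  exact: le_trans (ler_norm _) H.
split => //.
  apply/cvgrPdist_le => e e0; move/cvgrPdist_le: lim => /(_ _ e0); apply: filterS => n.
  rewrite sub0r normrN (ger0_norm (normc_ge0 _)); apply: le_trans.
  by rewrite distrC -ReN -ReD normr_Re_le.
apply/cvgrPdist_le => e e0; move/cvgrPdist_le: lim => /(_ _ e0); apply: filterS => n.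
rewrite sub0r normrN (ger0_norm (normc_ge0 _)); apply: le_trans.
by rewrite distrC -ImN -ImD normr_Im_le.
Qed.

End circle_integrals.

(** * Coordinates on SE(2) *)

Section angles.
Context {R : realType}.

Lemma ler_sin_norm (t : R) : `|sin t| <= `|t|.
Proof.
have H (x : R) : 0 <= x -> `|sin x| <= x.
  move=> x0; have [|c _] := @MVT_segment _ (@sin R) (@cos R) 0 x x0.
    by apply: continuous_subspaceT; exact: continuous_sin.
  rewrite sin0 !subr0 => ->; rewrite normrM (ger0_norm x0) ler_piMl//.
  by rewrite ler_norml cos_geN1 cos_le1.
have [/H h|t0] := leP 0 t; first exact: le_trans h (ler_norm t).
by have := H (- t); rewrite oppr_ge0 (ltW t0) sinN normrN (ltr0_norm t0); apply.
Qed.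

Lemma normc_expi_sub (s t : R) :
  normc (expi s - expi t) ^+ 2 = 2 * (1 - cos (s - t)).
Proof.
rewrite normcE sqr_sqrtr ?addr_ge0 ?sqr_ge0//= cosB.
have := cos2Dsin2 s; have := cos2Dsin2 t; lra.
Qed.

(** Half-angle formula: 2(1 - cos u) = 4 sin(u/2)^2, and |sin v| <= |v|. *)
Lemma normc_expi_sub_le (s t : R) :
  normc (expi s - expi t) ^+ 2 <= (s - t) ^+ 2.
Proof.
rewrite normc_expi_sub; set u := s - t.
have -> : cos u = 1 - (sin (u / 2)) ^+ 2 *+ 2.
  have := cosD (u / 2) (u / 2); rewrite -splitr => ->.
  by have := cos2Dsin2 (u / 2); rewrite -!expr2; lra.
have : sin (u / 2) ^+ 2 <= (u / 2) ^+ 2.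
  rewrite -[leLHS]real_normK ?num_real// -[leRHS]real_normK ?num_real//.
  by rewrite lerXn2r ?nnegrE// ler_sin_norm.
lra.
Qed.

(** Induction on |m| with the product rule for differences. The bound is stated through the periodic
    quantity 1 - cos, not (s - t)^2, because that is what the Fejer moment controls. *)
Lemma normc_expi_int_sub_le (m : int) (s t : R) :
  normc (expi (m%:~R * s) - expi (m%:~R * t)) ^+ 2 <=
  2 * m%:~R ^+ 2 * (1 - cos (s - t)).
Proof.
have H (k : nat) : normc (expi (k%:R * s) - expi (k%:R * t)) <=
    k%:R * normc (expi s - expi t).
  elim: k => [|k IH].
    by rewrite !mul0r subrr normcE /= expr0n addr0 sqrtr0.
  rewrite -natr1 !mulrDl !mul1r !expiD.
  have -> : expi (k%:R * s) * expi s - expi (k%:R * t) * expi t =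
     (expi (k%:R * s) - expi (k%:R * t)) * expi s
     + expi (k%:R * t) * (expi s - expi t) by ring.
  apply: (le_trans (normc_leD _ _)).
  by rewrite !Normc.normcM !normc_expi mulr1 mul1r lerD2r.
have K : normc (expi (m%:~R * s) - expi (m%:~R * t)) <=
    `|m%:~R| * normc (expi s - expi t).
  case: m => k; first by rewrite normr_nat; exact: H.
  rewrite NegzE mulrNz !mulNr !expiN -rmorphB normc_conjc normrN normr_nat.
  exact: H.
have := @lerXn2r _ 2 _ _ (normc_ge0 _) _ K.
rewrite nnegrE mulr_ge0 ?normc_ge0// => /(_ isT)/le_trans; apply.
by rewrite exprMn real_normK ?num_real// normc_expi_sub mulrCA mulrA.
Qed.

(** [acos] covers the upper half circle; for s < 0 it is reflected to 2 pi - acos c. There acos c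
    cannot be 0, since its sine is not, so the angle stays strictly below 2 pi. *)
Lemma unit_angle (c s : R) : c ^+ 2 + s ^+ 2 = 1 ->
  exists t, [/\ 0 <= t < 2 * pi, c = cos t & s = sin t].
Proof.
move=> cs.
have c1 : -1 <= c <= 1.
  by have s20 := sqr_ge0 s; apply/andP; split; nra.
have cn := acosK c1; have a0 := acos_ge0 c1; have api := acos_lepi c1.
have sa := sin_acos c1.
have s2 : 1 - c ^+ 2 = s ^+ 2 by rewrite -cs addrC addKr.
rewrite s2 sqrtr_sqr in sa.
have pi0 := pi_gt0 R.
have [s0|s0] := leP 0 s.
  exists (acos c); split; [|by rewrite cn|by rewrite sa ger0_norm].
  by rewrite a0 /=; lra.
exists (2 * pi - acos c).
have -> : cos (2 * pi - acos c) = c.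
  by rewrite addrC mulr_natl cosD2pi cosN cn.
have -> : sin (2 * pi - acos c) = s.
  by rewrite addrC mulr_natl sinD2pi sinN sa ltr0_norm// opprK.
split => //.
have : acos c != 0.
  apply/eqP => a00; move: sa; rewrite a00 sin0 => /eqP.
  by rewrite eq_sym normr_eq0 lt_eqF.
move=> h; have ap : 0 < acos c by rewrite lt_def h a0.
by apply/andP; split; lra.
Qed.

(** The default of [xget] is never reached: at the origin the angle 0 qualifies, elsewhere the
    normalized point has an angle by [unit_angle]. *)
Lemma polar_PhiP (x y : R) : let t := polar_Phi x y in
  [/\ 0 <= t < 2 * pi, x = polar_rho x y * cos t & y = polar_rho x y * sin t].
Proof.
rewrite /polar_Phi; case: xgetP => [t _ //|H]; exfalso.
have [r0|r0] := eqVneq (polar_rho x y) 0.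
  have : x ^+ 2 + y ^+ 2 = 0.
    by rewrite -[LHS]sqr_sqrtr ?addr_ge0 ?sqr_ge0// -/(polar_rho x y) r0 expr0n.
  move=> /eqP; rewrite paddr_eq0 ?sqr_ge0// !sqrf_eq0 => /andP[/eqP x0 /eqP y0].
  apply: (H 0); split; rewrite ?r0 ?mul0r//.
  by rewrite lexx mulr_gt0 ?pi_gt0.
have := @unit_angle (x / polar_rho x y) (y / polar_rho x y).
case.
  rewrite !expr_div_n -mulrDl sqr_sqrtr ?addr_ge0 ?sqr_ge0// mulfV//.
  by rewrite -[_ + _]sqr_sqrtr ?addr_ge0 ?sqr_ge0// sqrf_eq0.
move=> t [t1 t2 t3]; apply: (H t); split => //.
  by rewrite -t2 mulrC divfK.
by rewrite -t3 mulrC divfK.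
Qed.

Lemma expi_polar_Phi (c s : R) : c ^+ 2 + s ^+ 2 = 1 ->
  expi (polar_Phi c s) = Complex c s.
Proof.
move=> cs; have [_] := polar_PhiP c s.
by rewrite /polar_rho cs sqrtr1 !mul1r /expi => <- <-.
Qed.

(** The two angles agree only modulo 2 pi, which integer powers of the exponential do not see. *)
Lemma expi_int_polar_Phi (n : int) (t : R) :
  expi (n%:~R * polar_Phi (cos t) (sin t)) = expi (n%:~R * t).
Proof.
set u := polar_Phi _ _.
have E : expi u = expi t by rewrite expi_polar_Phi ?cos2Dsin2.
have H (k : nat) : expi (k%:R * u) = expi (k%:R * t).
  elim: k => [|k IH]; first by rewrite !mul0r.
  by rewrite -natr1 !mulrDl !mul1r !expiD IH E.
by case: n => k; [exact: H|rewrite NegzE mulrNz !mulNr !expiN; congr conjc; exact: H].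
Qed.

(** Powers and conjugates of exp(ih) suffice, so the angle h itself need not be known to be
    measurable. This matters for [SE2_theta], which is picked by choice. *)
Lemma Cmeasurable_expi_int {d} {T : measurableType d} (n : int) (h : T -> R) :
  Cmeasurable setT (fun x => expi (h x)) ->
  Cmeasurable setT (fun x => expi (n%:~R * h x)).
Proof.
move=> mh.
have H (k : nat) : Cmeasurable setT (fun x => expi (k%:R * h x)).
  elim: k => [|k IH].
    by under eq_fun do rewrite mul0r; exact: Cmeasurable_cst.
  under eq_fun do rewrite -natr1 mulrDl mul1r expiD.
  exact: CmeasurableM.
case: n => k; first exact: H.
under eq_fun do rewrite NegzE mulrNz mulNr expiN.
exact: (Cmeasurable_conjc (H k.+1)).
Qed.

End angles.

Section SE2_geometry.
Context {R : realType}.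
Implicit Types (A : SO2 R) (g : SE2 R).

Let sum2 (F : 'I_2 -> R) : \sum_(i < 2) F i = F 0 + F 1.
Proof.
by rewrite !big_ord_recl big_ord0 addr0; congr (_ + F _); apply: val_inj.
Qed.

(** For rows (a, b) and (c, d), (a - d)^2 + (b + c)^2 is the sum of the two squared column norms
    minus twice the determinant, that is 2 - 2 = 0. *)
Lemma SO2_entries A : [/\ val A 0 1 = - val A 1 0, val A 1 1 = val A 0 0 &
  val A 0 0 ^+ 2 + val A 1 0 ^+ 2 = 1].
Proof.
have [/matrixP A1] := SO2P A.
rewrite (expand_det_row _ 0) !sum2 /cofactor !det_mx11 !mxE /=.
have -> : lift (0 : 'I_2) (0 : 'I_1) = 1 by apply: val_inj.
have -> : lift (1 : 'I_2) (0 : 'I_1) = 0 by apply: val_inj.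
rewrite expr0 mul1r /bump /= expr1 mulN1r.
have := A1 0 0; have := A1 1 1; rewrite !mxE !sum2 !mxE /=.
move: (val A 0 0) (val A 0 1) (val A 1 0) (val A 1 1) => a b c d e1 e2 e3.
have : (a - d) ^+ 2 + (b + c) ^+ 2 = 0 by lra.
move/eqP; rewrite paddr_eq0 ?sqr_ge0// !sqrf_eq0 subr_eq0 addr_eq0.
by move=> /andP[/eqP ad /eqP bc]; split => //; rewrite -!expr2 in e2.
Qed.

Lemma SE2_thetaP g :
  expi (SE2_theta g) = Complex (val g.2 0 0) (val g.2 1 0).
Proof. by rewrite /SE2_theta expi_polar_Phi//; have [] := SO2_entries g.2. Qed.

Lemma cos_SE2_theta g : cos (SE2_theta g) = val g.2 0 0.
Proof. by have [] := SE2_thetaP g. Qed.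

Lemma sin_SE2_theta g : sin (SE2_theta g) = val g.2 1 0.
Proof. by have [] := SE2_thetaP g. Qed.

Lemma dotE (u t : 'cV[R]_2) : dot u t = u 0 0 * t 0 0 + u 1 0 * t 1 0.
Proof. by rewrite /dot mxE sum2 !mxE. Qed.

Lemma mulmx_col2 (A : 'M[R]_2) (u : 'cV[R]_2) i :
  (A *m u) i 0 = A i 0 * u 0 0 + A i 1 * u 1 0.
Proof. by rewrite mxE sum2. Qed.

(** The inverse of (x, R) has translation part - R^T x; moving R^T across the dot product turns the
    point u_a into R u_a, whose angle is a + theta. *)
Lemma Urep_S1basisE (p : R) g (n : int) (a : R) :
  Urep p (g^-1)%g (S1basis n) (S1_angle a) =
  expi (- (p * (cos (a + SE2_theta g) * g.1 0 0 + sin (a + SE2_theta g) * g.1 1 0)))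
  * expi (n%:~R * (a + SE2_theta g)).
Proof.
have [A01 A11 _] := SO2_entries g.2.
have ct := cos_SE2_theta g; have st := sin_SE2_theta g.
have rot0 : (val g.2 *m vec2 (cos a) (sin a)) 0 0 = cos (a + SE2_theta g).
  by rewrite mulmx_col2 !mxE /= A01 cosD ct st mulNr mulrC [_ * sin a]mulrC.
have rot1 : (val g.2 *m vec2 (cos a) (sin a)) 1 0 = sin (a + SE2_theta g).
  by rewrite mulmx_col2 !mxE /= A11 sinD ct st addrC mulrC [_ * cos a]mulrC.
rewrite /Urep; congr (_ * _).
  congr expi; rewrite dotE cosD sinD ct st.
  have -> : (g^-1)%g = (- ((val g.2)^T *m g.1), SO2_inv g.2) by [].
  have opp (u : 'cV[R]_2) i : (- u) i 0 = - u i 0 by rewrite mxE.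
  rewrite /= !opp !mulmx_col2 ![_^T _ _]mxE.
  by rewrite ![vec2 _ _ _ _]mxE /= A01 A11; ring.
by rewrite /S1basis /= trmxK rot0 rot1 expi_int_polar_Phi.
Qed.

End SE2_geometry.

Section SE2_measurability.
Variable R : realType.
Local Notation mR := (measurableTypeR R).

Lemma continuous_SE2_measurable (h : SE2 R -> R) : continuous h ->
  measurable_fun setT (h : SE2 R -> mR).
Proof.
move=> ch; apply: (measurability _ (RGenOpens.measurableE R)) => //.
move=> _ [_ [a [b ->]] <-]; rewrite setTI; apply: sub_sigma_algebra.
by move/continuousP: ch; apply; exact: interval_open.
Qed.

Lemma continuous_coord (m n : nat) (i : 'I_m) (j : 'I_n) :
  continuous (fun A : 'M[R]_(m, n) => A i j).
Proof.
move=> A B /= nB; exists (fun i' j' => if (i', j') == (i, j) then B else setT).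
  move=> i' j'; case: eqP => [[-> ->]//|_]; exact: filterT.
by move=> C /= /(_ i j); rewrite eqxx.
Qed.

Lemma measurable_SE2_x (i : 'I_2) : measurable_fun setT (fun g : SE2 R => g.1 i 0 : mR).
Proof.
apply: continuous_SE2_measurable => g.
apply: (@continuous_comp _ _ _ fst (fun A : 'cV[R]_2 => A i 0)).
  exact: cvg_fst.
exact: continuous_coord.
Qed.

Lemma measurable_SE2_rot (i j : 'I_2) :
  measurable_fun setT (fun g : SE2 R => val g.2 i j : mR).
Proof.
apply: continuous_SE2_measurable => g.
apply: (@continuous_comp _ _ _ snd (fun A : SO2 R => val A i j)).
  exact: cvg_snd.
apply: (@continuous_comp (SO2 R) 'M[R]_2 R val (fun A => A i j) g.2).
  exact: initial_continuous.
exact: continuous_coord.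
Qed.

Lemma Cmeasurable_SE2_theta (n : int) :
  Cmeasurable setT (fun g : SE2 R => expi (n%:~R * SE2_theta g)).
Proof.
apply: Cmeasurable_expi_int; under eq_fun do rewrite SE2_thetaP.
by split; exact: measurable_SE2_rot.
Qed.

Definition SE2_box (r : R) : set (SE2 R) :=
  [set g : SE2 R | `|g.1 0 0| <= r /\ `|g.1 1 0| <= r].

Lemma measurable_SE2_box r : measurable (SE2_box r).
Proof.
rewrite (_ : SE2_box r = (fun g : SE2 R => g.1 0 0 : mR) @^-1` `[- r, r]
                     `&` (fun g : SE2 R => g.1 1 0 : mR) @^-1` `[- r, r]).
  by apply: measurableI; rewrite -[X in measurable X]setTI;
    apply: measurable_SE2_x => //; exact: measurable_itv.
by apply/seteqP; split => g; rewrite /SE2_box /= !in_itv /= -!ler_norml => -[].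
Qed.

(** Only translations need a bound, the chart having a bounded angular interval. Sigma-finiteness of
    [haar], required by Fubini, follows. *)
Lemma haar_SE2_box r : (haar (SE2_box r) < +oo)%E.
Proof.
have mP : measurable (@SE2_param R @^-1` SE2_box r).
  by rewrite -[X in measurable X]setTI; apply: SE2_param_measurable => //;
    exact: measurable_SE2_box.
rewrite /haar /pushforward /mscale /= /mrestr lte_mul_pinfty//.
  by rewrite lee_fin invr_ge0 mulr_ge0// exprn_ge0// pi_ge0.
set I : set mR := `[- r, r]%classic; set J : set mR := `[0, 2 * pi[%classic.
have mI : measurable I by exact: measurable_itv.
have mJ : measurable J by exact: measurable_itv.
have mIIJ : measurable (I `*` I `*` J) by do 2 (apply: measurableX => //).
have sub : @SE2_param R @^-1` SE2_box r `&` @SE2_chart R `<=` I `*` I `*` J.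
  move=> [[x y] t] [] /= [+ +] [_ /=]; rewrite !mxE /= !ler_norml => hx hy ht.
  by split => //=; split => /=; rewrite in_itv.
have mA : measurable (@SE2_param R @^-1` SE2_box r `&` @SE2_chart R).
  by apply: measurableI => //; exact: measurable_SE2_chart.
have F a b (s t : bool) : @lebesgue_measure R [set` Interval (BSide s a) (BSide t b)] \is a fin_num.
  by rewrite lebesgue_measure_itv; case: ifP.
have E : ((@lebesgue_measure R \x @lebesgue_measure R \x @lebesgue_measure R)%E
    (I `*` I `*` J) < +oo)%E.
  rewrite product_measure1E//; last exact: measurableX.
  have E2 : (@lebesgue_measure R \x @lebesgue_measure R)%E (I `*` I) =
      (@lebesgue_measure R I * @lebesgue_measure R I)%E by rewrite product_measure1E.
  rewrite [X in (X * _ < _)%E]E2 ltey_eq.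
  have FI := F (- r) r true false; have FJ := F 0 (2 * pi) true true.
  by rewrite !fin_numM.
exact: (le_lt_trans (le_measure _ (mem_set mA) (mem_set mIIJ) sub) E).
Qed.

Lemma haar_sigma_finite : sigma_finite setT (@haar R).
Proof.
exists (fun n => SE2_box n%:R).
  apply/esym/seteqP; split => // g _.
  exists (Num.truncn (Num.max `|g.1 0 0| `|g.1 1 0|)).+1 => //=.
  by split; apply: le_trans (ltW (truncnS_gt _)); rewrite le_max lexx ?orbT.
by move=> n; split; [exact: measurable_SE2_box|exact: haar_SE2_box].
Qed.

HB.instance Definition _ := @Measure_isSigmaFinite.Build _ _ _ (@haar R) haar_sigma_finite.

End SE2_measurability.

(** * Fourier coefficients on SE(2) *)

Section fourier_coefficients.
Variable R : realType.
Local Notation mR := (measurableTypeR R).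
Local Notation circ := (@circle_measure R).
Local Notation haar := (@haar R).

Lemma Lq2P {d} {T : measurableType d} (mu : {measure set T -> \bar R})
    (h : T -> R[i]) :
  Lq mu 2%:E h <->
  Cmeasurable setT h /\ (\int[mu]_x (normc (h x) ^+ 2)%:E < +oo)%E.
Proof.
have E : (\int[mu]_x (`|(normc (h x))%:E| `^ 2) =
          \int[mu]_x (normc (h x) ^+ 2)%:E)%E.
  apply: eq_integral => x _.
  by rewrite /= ger0_norm ?normc_ge0// powR_mulrn ?normc_ge0.
rewrite /Lq /finite_norm; split => -[mh fin]; split => //.
  by rewrite -E -poweR_Lnorm// poweR_lty.
by rewrite unlock poweR_lty// E.
Qed.

Lemma bounded_circle_L2 (h : mR -> R[i]) (M : R) : Cmeasurable setT h ->
  (forall x, normc (h x) <= M) -> Lq circ 2%:E h.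
Proof.
move=> mh hM; apply/Lq2P; split=> //.
have : circ.-integrable setT (EFin \o (fun x => normc (h x) ^+ 2)).
  apply: (@circle_integrable _ _ (M ^+ 2)).
    by apply: measurable_funX; exact: measurable_normc.
  move=> x; rewrite ger0_norm ?sqr_ge0// lerXn2r ?nnegrE ?normc_ge0//.
  exact: le_trans (normc_ge0 _) (hM x).
move=> /integrableP[_]; congr (_ < _)%E; apply: eq_integral => x _ /=.
by rewrite ger0_norm// sqr_ge0.
Qed.

(** On a probability space the pointwise bound x <= 1 + x^2 does the work of Cauchy-Schwarz. *)
Lemma circle_L2_Cintegrable (h : mR -> R[i]) : Lq circ 2%:E h -> Cintegrable circ h.
Proof.
move=> /Lq2P[mh fin].
have i2 : circ.-integrable setT (EFin \o (fun x => normc (h x) ^+ 2)).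
  apply/integrableP; split.
    by apply/measurable_EFinP; apply: measurable_funX; exact: measurable_normc.
  move: fin; congr (_ < _)%E; apply: eq_integral => x _ /=.
  by rewrite ger0_norm// sqr_ge0.
apply: (@le_Cintegrable _ _ _ circ _ (fun x => 1 + normc (h x) ^+ 2)) => //.
  have i1 : circ.-integrable setT (EFin \o (fun=> 1)).
    by apply: (@circle_integrable _ _ 1) => // x; rewrite normr1.
  exact: (integrableD measurableT i1 i2).
by move=> x; have := sqr_ge0 (normc (h x) - 1); nra.
Qed.

Variable f : SE2 R -> R[i].
Hypothesis fi : Cintegrable haar f.

Lemma Cmeasurable_expi_addfst (n : int) :
  Cmeasurable setT (fun z : SE2 R * mR => expi (n%:~R * (z.2 + SE2_theta z.1))).
Proof.
apply: Cmeasurable_expi_int; under eq_fun do rewrite expiD.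
apply: CmeasurableM.
  exact: (Cmeasurable_expi measurable_snd).
apply: (Cmeasurable_comp (f := fun g => expi (SE2_theta g))) => //.
by have := @Cmeasurable_SE2_theta R 1; under eq_fun do rewrite mul1r.
Qed.

Definition plane_wave (p : R) (g : SE2 R) (b : R) : R[i] :=
  expi (- (p * (cos b * g.1 0 0 + sin b * g.1 1 0))).

Lemma Cmeasurable_plane_wave (p : R) :
  Cmeasurable setT (fun z : SE2 R * mR => plane_wave p z.1 (z.2 + SE2_theta z.1)).
Proof.
have [m1 m2] := Cmeasurable_expi_addfst 1.
have mc : measurable_fun setT (fun z : SE2 R * mR => cos (z.2 + SE2_theta z.1)).
  by apply: eq_measurable_fun m1 => z _; rewrite /= mul1r.
have ms : measurable_fun setT (fun z : SE2 R * mR => sin (z.2 + SE2_theta z.1)).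
  by apply: eq_measurable_fun m2 => z _; rewrite /= mul1r.
have mx i : measurable_fun setT (fun z : SE2 R * mR => z.1.1 i 0).
  exact: (measurableT_comp (@measurable_SE2_x R i) measurable_fst).
apply: Cmeasurable_expi; apply: measurableT_comp => //.
apply: measurable_funM => //; apply: measurable_funD; exact: measurable_funM.
Qed.

Lemma normc_plane_wave p g b : normc (plane_wave p g b) = 1.
Proof. exact: normc_expi. Qed.

Definition Ubasis (p : R) (n : int) (z : SE2 R * mR) : R[i] :=
  plane_wave p z.1 (z.2 + SE2_theta z.1) * expi (n%:~R * (z.2 + SE2_theta z.1)).

Lemma UbasisE p n g a :
  Urep p (g^-1)%g (S1basis n) (S1_angle a) = Ubasis p n (g, a).
Proof. exact: Urep_S1basisE. Qed.

Lemma Cmeasurable_Ubasis p n : Cmeasurable setT (Ubasis p n).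
Proof.
by apply: CmeasurableM; [exact: Cmeasurable_plane_wave|exact: Cmeasurable_expi_addfst].
Qed.

Lemma normc_Ubasis p n z : normc (Ubasis p n z) = 1.
Proof. by rewrite Normc.normcM normc_plane_wave normc_expi mulr1. Qed.

Lemma S1basis_angle (m : int) (a : R) :
  S1basis m (S1_angle a) = expi (m%:~R * a) :> R[i].
Proof. by rewrite /S1basis /= !mxE /= expi_int_polar_Phi. Qed.

Lemma S1basis_angle_comp (m : int) :
  @S1basis R m \o @S1_angle R = (fun a => expi (m%:~R * a)).
Proof. by apply/funext => a; exact: S1basis_angle. Qed.

Lemma Ubasis_comp p n g :
  Urep p (g^-1)%g (S1basis n) \o @S1_angle R = (fun a => Ubasis p n (g, a)).
Proof. by apply/funext => a; exact: UbasisE. Qed.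

Lemma Cmeasurable_expi_mull (r : R) : Cmeasurable setT (fun a : mR => expi (r * a)).
Proof. by apply: Cmeasurable_expi; apply: measurable_funM. Qed.

Lemma S1L2_basis (m : int) : S1L2 (@S1basis R m).
Proof.
rewrite /S1L2 S1basis_angle_comp.
apply: (@bounded_circle_L2 _ 1); first exact: Cmeasurable_expi_mull.
by move=> x; rewrite normc_expi.
Qed.

Lemma Cintegrable_fU p n (h : mR -> R[i]) : Cintegrable circ h ->
  Cintegrable (haar \x circ)%E (fun z => f z.1 * Ubasis p n z * conjc (h z.2)).
Proof.
move=> hi; apply: (@Cintegrable_prod _ _ _ _ _ _ _ _ (fun g => normc (f g))
    (fun a => normc (h a))).
- apply: CmeasurableM; last first.
    apply: Cmeasurable_conjc; apply: (Cmeasurable_comp measurable_snd).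
    exact: Cintegrable_measurable hi.
  apply: CmeasurableM; last exact: Cmeasurable_Ubasis.
  by apply: (Cmeasurable_comp measurable_fst); exact: Cintegrable_measurable fi.
- by move=> x; exact: normc_ge0.
- by move=> x; exact: normc_ge0.
- exact: Cintegrable_normc.
- exact: Cintegrable_normc.
- by move=> z; rewrite 2!Normc.normcM normc_Ubasis normc_conjc mulr1.
Qed.

Lemma circle_Cintegrable1 : Cintegrable circ (fun=> 1 : R[i]).
Proof.
by apply: (@circle_Cintegrable _ _ (normc 1)) => //; exact: Cmeasurable_cst.
Qed.

Lemma Cmeasurable_Ubasis1 p n (a : mR) : Cmeasurable setT (fun g => Ubasis p n (g, a)).
Proof. exact: (Cmeasurable_comp (pair2_measurable a) (Cmeasurable_Ubasis p n)). Qed.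

Lemma Cmeasurable_Ubasis2 p n g : Cmeasurable setT (fun a : mR => Ubasis p n (g, a)).
Proof. exact: (Cmeasurable_comp (pair1_measurable g) (Cmeasurable_Ubasis p n)). Qed.

(** [fourier] is a choice, so a weak integral has to exist. The pointwise integral of f(g) U_p(g^-1)
    e_n is one: U_p(g^-1) e_n has modulus 1, so it is bounded by a multiple of the L^1 norm of f,
    and Fubini gives the pairing identity. *)
Lemma fourier_S1basisP p n (h : S1 R -> R[i]) : S1L2 h ->
  S1inner (fourier f p (S1basis n)) h =
  Cintegral haar (fun g => f g * S1inner (Urep p (g^-1)%g (S1basis n)) h).
Proof.
rewrite /fourier; case: xgetP => [w _ [_ +] Hh|H]; first exact.
exfalso; pose w u := Cintegral haar (fun g => f g * Urep p (g^-1)%g (S1basis n) u).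
apply: (H w) => {h H}.
have wE a : w (S1_angle a) = Cintegral haar (fun g => f g * Ubasis p n (g, a)).
  by rewrite /w; congr Cintegral; apply/funext => g; rewrite UbasisE.
have ifU a : Cintegrable haar (fun g => f g * Ubasis p n (g, a)).
  apply: (@CintegrableM _ _ _ _ _ _ 1 fi); first exact: Cmeasurable_Ubasis1.
  by move=> g; rewrite normc_Ubasis.
split.
  apply: (@bounded_circle_L2 _ (2 * \int[haar]_g normc (f g))).
    (* Taking the constant 1 as test function makes the inner Fubini integral equal to w itself,
       which is therefore measurable. *)
    have := Cmeasurable_Cintegral2 (Cintegrable_fU p n circle_Cintegrable1).
    congr Cmeasurable; apply/funext => a; rewrite [RHS]wE.
    by congr Cintegral; apply/funext => g; rewrite conjc1 mulr1.
  move=> a; rewrite [X in normc X]wE; apply: normc_Cintegral_le => //.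
    exact: Cintegrable_normc.
  by move=> g; rewrite Normc.normcM normc_Ubasis mulr1.
move=> h hL2; have hi := circle_L2_Cintegrable hL2.
have -> : S1inner w h = Cintegral circ (fun a => w (S1_angle a) * conjc (h (S1_angle a))).
  by [].
transitivity (Cintegral circ (fun a => Cintegral haar
    (fun g => f g * Ubasis p n (g, a) * conjc (h (S1_angle a))))).
  by congr Cintegral; apply/funext => a; rewrite wE CintegralZr.
have chi : Cintegrable circ (fun a => conjc (h (S1_angle a))).
  have [h1 h2] := hi; split; first by under eq_fun do rewrite Re_conjc.
  by under eq_fun do rewrite Im_conjc EFinN; exact: integrableN.
have iU g : Cintegrable circ (fun a => Ubasis p n (g, a) * conjc (h (S1_angle a))).
  under eq_fun do rewrite mulrC.
  apply: (@CintegrableM _ _ _ _ _ _ 1 chi); first exact: Cmeasurable_Ubasis2.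
  by move=> a; rewrite normc_Ubasis.
rewrite -(Cintegral_Fubini (Cintegrable_fU p n hi)).
- congr Cintegral; apply/funext => g.
  rewrite /S1inner Ubasis_comp /Cinner -CintegralZ//.
  by congr Cintegral; apply/funext => a; rewrite -mulrA.
- move=> g /=; under eq_fun do rewrite -mulrA.
  exact: CintegrableZ.
- by move=> a /=; under eq_fun do rewrite mulrC; exact: CintegrableZ.
Qed.

(** The index n occurs only in the last factor. At fixed g the Fejer means over n are thus integrals
    of the first two factors against the kernel centred at a = c - theta. *)
Definition angular_coef (p : R) (n m : int) (c : R) (g : SE2 R) : R[i] :=
  Cintegral circ (fun a => plane_wave p g (a + SE2_theta g)
    * expi (- (m%:~R * a)) * expi (n%:~R * (a + (SE2_theta g - c)))).

Lemma angular_coefE p n m c g :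
  expi (- (n%:~R * c)) * S1inner (Urep p (g^-1)%g (S1basis n)) (S1basis m) =
  angular_coef p n m c g.
Proof.
rewrite /S1inner Ubasis_comp S1basis_angle_comp /Cinner -CintegralZ; last first.
  apply: (@circle_Cintegrable _ _ 1).
    apply: CmeasurableM; first exact: Cmeasurable_Ubasis2.
    by apply: Cmeasurable_conjc; exact: Cmeasurable_expi_mull.
  by move=> a; rewrite Normc.normcM normc_conjc normc_Ubasis normc_expi mulr1.
congr Cintegral; apply/funext => a; rewrite -expiN.
by rewrite addrA [n%:~R * (_ - c)]mulrBr expiD /Ubasis /=; ring.
Qed.

Lemma fourier_coefE p n m c :
  expi (- (n%:~R * c)) * fourier_coef f p n m =
  Cintegral haar (fun g => f g * angular_coef p n m c g)
  /\ Cintegrable haar (fun g => f g * angular_coef p n m c g).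
Proof.
pose e (a : mR) : R[i] := expi (m%:~R * a).
have me : Cmeasurable setT e by exact: Cmeasurable_expi_mull.
have ie : Cintegrable circ e.
  by apply: (@circle_Cintegrable _ _ 1) => // x; rewrite normc_expi.
pose G g := Cintegral circ (fun a => f g * Ubasis p n (g, a) * conjc (e a)).
have GE g : G g = f g * S1inner (Urep p (g^-1)%g (S1basis n)) (S1basis m).
  rewrite /G /S1inner Ubasis_comp S1basis_angle_comp /Cinner -CintegralZ.
    by congr Cintegral; apply/funext => a; rewrite mulrA.
  apply: (@circle_Cintegrable _ _ 1).
    by apply: CmeasurableM; [exact: Cmeasurable_Ubasis2|exact: Cmeasurable_conjc].
  by move=> a; rewrite Normc.normcM normc_conjc normc_Ubasis normc_expi mulr1.
have mG : Cmeasurable setT G.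
  have [F1 F2] := Cintegrable_fU p n ie.
  by split => /=; apply: measurableT_comp => //;
    [exact: (measurable_fubini_F F1)|exact: (measurable_fubini_F F2)].
have iG : Cintegrable haar G.
  apply: (@le_Cintegrable _ _ _ _ _ (fun g => 2 * normc (f g))) => //.
    under eq_fun do rewrite EFinM; apply: integrableZl => //.
    exact: Cintegrable_normc.
  (* The circle has mass 1, so the constant |f(g)| can serve as the integrand dominating the inner
     integral. *)
  move=> g; have -> : normc (f g) = \int[circ]_a normc (f g).
    by rewrite Rintegral_cst// [X in fine X]circle_measureT mulr1.
  apply: normc_Cintegral_le.
  - apply: (@circle_Cintegrable _ _ (normc (f g))).
      apply: CmeasurableM; last exact: Cmeasurable_conjc.
      by apply: CmeasurableM; [exact: Cmeasurable_cst|exact: Cmeasurable_Ubasis2].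
    by move=> a; rewrite 2!Normc.normcM normc_conjc normc_Ubasis normc_expi !mulr1.
  - by apply: (@circle_integrable _ _ (normc (f g))) => // x; rewrite ger0_norm ?normc_ge0.
  - by move=> a; rewrite 2!Normc.normcM normc_conjc normc_Ubasis normc_expi !mulr1.
have AE : (fun g => f g * angular_coef p n m c g) =
          (fun g => expi (- (n%:~R * c)) * G g).
  by apply/funext => g; rewrite -angular_coefE GE mulrCA.
rewrite AE; split; last exact: CintegrableZ.
rewrite CintegralZ//; congr (_ * _).
rewrite /fourier_coef fourier_S1basisP; last exact: S1L2_basis.
by congr Cintegral; apply/funext => g; rewrite GE.
Qed.

End fourier_coefficients.

(** * Pointwise Fejer limit and its passage through the integral over SE(2) *)

Section Fourier_series_of_coefficients.
Variable R : realType.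
Local Notation mR := (measurableTypeR R).
Local Notation circ := (@circle_measure R).
Local Notation haar := (@haar R).
Variable f : SE2 R -> R[i].
Hypothesis fi : Cintegrable haar f.

(** The phase difference is p times the pairing of u_b - u_c with x; Cauchy-Schwarz applies, and the
    squared chord |u_b - u_c|^2 is 2(1 - cos(b - c)). *)
Lemma plane_wave_sub_le p g (b c : R) :
  normc (plane_wave p g b - plane_wave p g c) ^+ 2 <=
  2 * p ^+ 2 * (g.1 0 0 ^+ 2 + g.1 1 0 ^+ 2) * (1 - cos (b - c)).
Proof.
apply: (le_trans (normc_expi_sub_le _ _)).
rewrite cosB; set x := g.1 0 0; set y := g.1 1 0.
have H : ((cos b - cos c) * x + (sin b - sin c) * y) ^+ 2 <=
    ((cos b - cos c) ^+ 2 + (sin b - sin c) ^+ 2) * (x ^+ 2 + y ^+ 2).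
  have := sqr_ge0 ((cos b - cos c) * y - (sin b - sin c) * x); nra.
have E : (cos b - cos c) ^+ 2 + (sin b - sin c) ^+ 2 =
    2 * (1 - (cos b * cos c + sin b * sin c)).
  by have := cos2Dsin2 b; have := cos2Dsin2 c; lra.
rewrite E in H.
have -> : (- (p * (cos b * x + sin b * y)) - - (p * (cos c * x + sin c * y))) ^+ 2
   = p ^+ 2 * ((cos b - cos c) * x + (sin b - sin c) * y) ^+ 2 by ring.
apply: (le_trans (ler_wpM2l (sqr_ge0 p) H)).
by rewrite le_eqVlt; apply/orP; left; apply/eqP; ring.
Qed.

(** The value at a = c - theta of the first two factors under the integral in [angular_coef]. *)
Definition angular_limit (p : R) (m : int) (c : R) (g : SE2 R) : R[i] :=
  plane_wave p g c * expi (- (m%:~R * (c - SE2_theta g))).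

(** The bound 2 does not depend on g, which supplies the dominating function 2|f|; the constant [L]
    of the localization may depend on g, since it affects only the rate. *)
Lemma cvg_angular_fejer p m c g :
  let T n := fejer_mean (fun j => angular_coef p j m c g) n in
  [/\ forall n, normc (T n) <= 2,
      Re (T n) @[n --> \oo] --> Re (angular_limit p m c g) &
      Im (T n) @[n --> \oo] --> Im (angular_limit p m c g)].
Proof.
set t := SE2_theta g.
pose E (a : mR) : R[i] := plane_wave p g (a + t) * expi (- (m%:~R * a)).
(* The outer factors 2 come from (v + w)^2 <= 2v^2 + 2w^2 for the increments of plane wave and
   character; inside are the constants of [plane_wave_sub_le] and [normc_expi_int_sub_le]. *)
pose L := 2 * (2 * p ^+ 2 * (g.1 0 0 ^+ 2 + g.1 1 0 ^+ 2)) + 2 * (2 * m%:~R ^+ 2).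
have mE : Cmeasurable setT E.
  apply: CmeasurableM.
    exact: (Cmeasurable_comp (pair1_measurable g) (Cmeasurable_plane_wave p)).
  by under eq_fun do rewrite -mulNr; exact: Cmeasurable_expi_mull.
have EM x : normc (E x) <= 1.
  by rewrite Normc.normcM normc_plane_wave normc_expi mulr1.
have EL x : normc (E x - angular_limit p m c g) ^+ 2 <= L * (1 - cos (x + (t - c))).
  rewrite /E /angular_limit -/t.
  set A := plane_wave _ _ (x + t); set A0 := plane_wave _ _ c.
  set B := expi (- (m%:~R * x)); set B0 := expi (- (m%:~R * (c - t))).
  have -> : A * B - A0 * B0 = (A - A0) * B + A0 * (B - B0) by ring.
  have HA := plane_wave_sub_le p g (x + t) c; rewrite -/A -/A0 in HA.
  have HB := normc_expi_int_sub_le (- m) x (c - t).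
  rewrite !mulrNz !mulNr -/B -/B0 sqrrN opprB [x + (t - c)]addrA in HB.
  have := normc_leD ((A - A0) * B) (A0 * (B - B0)).
  rewrite !Normc.normcM normc_expi normc_plane_wave mulr1 mul1r => H.
  rewrite [x + (t - c)]addrA.
  have := normc_ge0 ((A - A0) * B + A0 * (B - B0)).
  move: HA HB H; rewrite /L.
  move: (normc _) (normc (A - A0)) (normc (B - B0)) (1 - _) => u v w k HA HB uvw u0.
  have : u ^+ 2 <= (v + w) ^+ 2.
    by rewrite lerXn2r ?nnegrE// (le_trans u0).
  have := sqr_ge0 (v - w); lra.
have [b r i] := @cvg_fejer_localization R E (angular_limit p m c g) 1 L (t - c) mE EM EL.
by split => // n; rewrite (le_trans (b n))// mulr1.
Qed.

Lemma Cintegrable_angular_limit (p : R) (m : int) (c : R) :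
  Cintegrable haar (fun g => f g * angular_limit p m c g).
Proof.
apply: (@CintegrableM _ _ _ _ _ _ 1 fi); last first.
  by move=> g; rewrite Normc.normcM normc_plane_wave normc_expi mulr1.
apply: CmeasurableM.
  apply: Cmeasurable_expi; apply: measurableT_comp => //.
  apply: measurable_funM => //.
  by apply: measurable_funD; apply: measurable_funM => //; exact: measurable_SE2_x.
have := CmeasurableM (Cmeasurable_cst setT (expi (- (m%:~R * c))))
   (@Cmeasurable_SE2_theta R m).
congr Cmeasurable; apply/funext => g.
by rewrite -expiD mulrBr opprB addrC.
Qed.

Lemma cvg_Rintegral_dominated (F : nat -> SE2 R -> R) (F0 h : SE2 R -> R) :
  (forall n, haar.-integrable setT (EFin \o F n)) ->
  haar.-integrable setT (EFin \o F0) -> haar.-integrable setT (EFin \o h) ->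
  (forall n g, `|F n g| <= h g) -> (forall g, F n g @[n --> \oo] --> F0 g) ->
  \int[haar]_g F n g @[n --> \oo] --> \int[haar]_g F0 g.
Proof.
move=> iF iF0 ih Fh FF0.
have cF g : (F n g)%:E @[n --> \oo] --> (F0 g)%:E.
  by apply: cvg_EFin; [exact: nearW|exact: FF0].
have [_ _] := @dominated_convergence _ _ _ haar setT measurableT
  (fun n => EFin \o F n) (EFin \o F0) (EFin \o h)
  (fun n => measurable_int _ (iF n)) (measurable_int _ iF0)
  (aeW _ (fun g _ => cF g)) ih
  (aeW _ (fun g n _ => Fh n g)).
rewrite -(fineK (integrable_fin_num measurableT iF0)).
by move=> /fine_cvgP [].
Qed.

Lemma Csum_fourier_coef (p : R) (m : int) (c : R) :
  Csummable (fun n => expi (- (n%:~R * c)) * fourier_coef f p n m) ->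
  Csum (fun n => expi (- (n%:~R * c)) * fourier_coef f p n m) =
  Cintegral haar (fun g => f g * angular_limit p m c g).
Proof.
set a := fun n => _; move=> sa.
pose T n g := fejer_mean (fun j => angular_coef p j m c g) n.
have aE j := (fourier_coefE fi p j m c).1.
have iA j := (fourier_coefE fi p j m c).2.
have TE n : (fun g => f g * T n g) = (fun g => n.+1%:R^-1 *
    \sum_(k < n.+1) \sum_(l < n.+1) f g * angular_coef p (k%:Z - l%:Z) m c g).
  apply/funext => g; rewrite /T /fejer_mean mulrCA mulr_sumr; congr (_ * _).
  by apply: eq_bigr => k _; rewrite mulr_sumr.
have iT n : Cintegrable haar (fun g => f g * T n g).
  by rewrite TE; apply: CintegrableZ; do 2 (apply: Cintegrable_sum => ?).
have intT n : Cintegral haar (fun g => f g * T n g) = fejer_mean a n.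
  rewrite TE CintegralZ; last by do 2 (apply: Cintegrable_sum => ?).
  rewrite Cintegral_sum; last by move=> k; apply: Cintegrable_sum.
  congr (_ * _); apply: eq_bigr => k _; rewrite Cintegral_sum//.
  by apply: eq_bigr => l _; rewrite /a aE.
have nf : haar.-integrable setT (EFin \o (fun g => 2 * normc (f g))).
  exact: (@integrableZl _ _ _ haar setT measurableT 2 _ (Cintegrable_normc fi)).
have iL := Cintegrable_angular_limit p m c.
have bT n g : normc (f g * T n g) <= 2 * normc (f g).
  have [b _ _] := cvg_angular_fejer p m c g.
  by rewrite Normc.normcM mulrC ler_wpM2r ?normc_ge0//; exact: b.
have cT g : Re (f g * T n g) @[n --> \oo] --> Re (f g * angular_limit p m c g) /\
            Im (f g * T n g) @[n --> \oo] --> Im (f g * angular_limit p m c g).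
  have [_ r i] := cvg_angular_fejer p m c g; split.
    rewrite ReM; under eq_fun do rewrite ReM.
    by apply: cvgB; apply: cvgM => //; exact: cvg_cst.
  rewrite ImM; under eq_fun do rewrite ImM.
  by apply: cvgD; apply: cvgM => //; exact: cvg_cst.
apply: eqC.
  apply: (cvg_unique (@Rhausdorff R) (cvg_fejer_mean (Csummable_Re sa))) => /=.
  have -> : fejer_mean (fun t => Re (a t)) =
            (fun n => \int[haar]_g Re (f g * T n g)).
    by apply/funext => n; rewrite -Re_fejer_mean -intT.
  apply: (cvg_Rintegral_dominated _ _ nf).
  - by move=> n; have [] := iT n.
  - by have [] := iL.
  - by move=> n g; apply: (le_trans (normr_Re_le _)).
  - by move=> g; have [] := cT g.
apply: (cvg_unique (@Rhausdorff R) (cvg_fejer_mean (Csummable_Im sa))) => /=.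
have -> : fejer_mean (fun t => Im (a t)) =
          (fun n => \int[haar]_g Im (f g * T n g)).
  by apply/funext => n; rewrite -Im_fejer_mean -intT.
apply: (cvg_Rintegral_dominated _ _ nf).
- by move=> n; have [] := iT n.
- by have [] := iL.
- by move=> n g; apply: (le_trans (normr_Im_le _)).
- by move=> g; have [] := cT g.
Qed.

(** The phases have modulus 1, and p > 0 places each coefficient below the supremum summed in
    [fourier_beta]. *)
Lemma admissible_Csummable (p : R) (m : int) (c : R) : admissible f -> 0 < p ->
  Csummable (fun n => expi (- (n%:~R * c)) * fourier_coef f p n m).
Proof.
move=> [_ adm] p0.
have beta : (fourier_beta f m < +oo)%E.
  by apply: le_lt_trans adm; apply: ereal_sup_ubound; exists m.
apply: le_lt_trans beta; apply: le_esum => n _.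
rewrite Normc.normcM normc_expi mul1r gee0_abs ?lee_fin ?normc_ge0//.
by apply: ereal_sup_ubound; exists p.
Qed.

End Fourier_series_of_coefficients.

(** * Unfolding over the lattice *)

Lemma matrix_continuous {R : realType} (T : topologicalType) (m n : nat)
    (F : T -> 'M[R]_(m, n)) :
  (forall i j, continuous (fun t => F t i j)) -> continuous F.
Proof.
move=> cF t A [P Pn PA]; apply: (filterS (P := fun s => forall i j, P i j (F s i j))).
  by move=> s Ps; apply: PA.
apply: filter_forall => i; apply: filter_forall => j.
exact: (cF i j t) (Pn i j).
Qed.

Lemma pair_continuous (T U V : topologicalType) (f : T -> U) (h : T -> V) :
  continuous f -> continuous h -> continuous (fun t => (f t, h t)).
Proof. by move=> cf ch t; apply: cvg_pair; [exact: cf|exact: ch]. Qed.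

(** * Lattice translations, unit cells and the lift of [psi] *)

Section lattice_translations.
Context {R : realType}.
Local Notation mR := (measurableTypeR R).
Implicit Types (g : SE2 R) (b c : int * int).

Lemma Z2_mul1 c g : (Z2_elt R c * g)%g.1 = vec2 c.1%:~R c.2%:~R + g.1.
Proof. by rewrite /= rotmx0 mul1mx. Qed.

Lemma Z2_mul2 c g : (Z2_elt R c * g)%g.2 = g.2.
Proof. by apply: val_inj; rewrite /= rotmx0 mul1mx. Qed.

Lemma Z2_mul10 c g : (Z2_elt R c * g)%g.1 0 0 = c.1%:~R + g.1 0 0.
Proof. by rewrite Z2_mul1 !mxE. Qed.

Lemma Z2_mul11 c g : (Z2_elt R c * g)%g.1 1 0 = c.2%:~R + g.1 1 0.
Proof. by rewrite Z2_mul1 !mxE. Qed.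

Lemma measurable_Z2_mul c : measurable_fun setT (fun g => (Z2_elt R c * g)%g).
Proof.
have cont : continuous (fun g : SE2 R => (Z2_elt R c * g)%g).
  have -> : (fun g => (Z2_elt R c * g)%g) =
      (fun g => (vec2 c.1%:~R c.2%:~R + g.1, g.2) : SE2 R).
    by apply/funext => g; rewrite [LHS]surjective_pairing Z2_mul1 Z2_mul2.
  have c1 : continuous (fun g : SE2 R => vec2 c.1%:~R c.2%:~R + g.1 : 'cV[R]_2).
    apply: matrix_continuous => i j.
    have -> : (fun h : SE2 R => (vec2 c.1%:~R c.2%:~R + h.1) i j) =
        (fun h => (vec2 c.1%:~R c.2%:~R : 'cV[R]_2) i j + h.1 i j).
      by apply/funext => h; rewrite mxE.
    move=> h; apply: cvgD; first exact: cvg_cst.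
    apply: (@continuous_comp _ _ _ fst (fun A : 'cV[R]_2 => A i j)).
      exact: cvg_fst.
    exact: continuous_coord.
  by apply: (pair_continuous c1) => g; exact: cvg_snd.
apply: (@measurability _ _ _ _ _ _ (@open (SE2 R))) => //.
move=> _ [U oU <-]; rewrite setTI; apply: sub_sigma_algebra.
by move/continuousP: cont; apply.
Qed.

Definition cell_of g : int * int := (Num.floor (g.1 0 0), Num.floor (g.1 1 0)).

Lemma cell_of_mul c g : cell_of (Z2_elt R c * g)%g = c + cell_of g.
Proof.
by rewrite /cell_of Z2_mul10 Z2_mul11 !floorDzr ?intr_int// !intrKfloor.
Qed.

Definition cell b : set (SE2 R) := [set g | cell_of g = b].

Lemma measurable_cell b : measurable (cell b).
Proof.
rewrite (_ : cell b =
    (fun g => g.1 0 0 : mR) @^-1` `[b.1%:~R, (b.1 + 1)%:~R[ `&`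
    (fun g => g.1 1 0 : mR) @^-1` `[b.2%:~R, (b.2 + 1)%:~R[).
  by apply: measurableI; rewrite -[X in measurable X]setTI;
    apply: measurable_SE2_x => //; exact: measurable_itv.
apply/seteqP; split => g; rewrite /cell /cell_of /= !in_itv /= -!floor_eq.
  by case: b => b1 b2 [-> ->]; rewrite !eqxx.
by move=> [/eqP -> /eqP ->]; case: b.
Qed.

Lemma haar_cell b : (haar (cell b) < +oo)%E.
Proof.
pose r : R := Num.max (`|b.1%:~R| + 1) (`|b.2%:~R| + 1).
have bnd (x : R) (n : int) : n%:~R <= x < (n + 1)%:~R -> `|x| <= `|n%:~R| + 1.
  rewrite intrD => /andP[h1 h2]; rewrite ler_norml.
  have := ler_norm (n%:~R : R); have := lerNnormlW (lexx `|n%:~R : R|).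
  by move=> h3 h4; apply/andP; split; lra.
have sub : cell b `<=` SE2_box r.
  move=> g; rewrite /cell /cell_of /= => gb.
  split; rewrite /r le_max; apply/orP; [left|right]; apply: bnd.
    by rewrite -floor_eq -gb.
  by rewrite -floor_eq -gb.
apply: (le_lt_trans (le_measure _ _ _ sub)); last exact: haar_SE2_box.
  by apply: mem_set; exact: measurable_cell.
by apply: mem_set; exact: measurable_SE2_box.
Qed.

Lemma measurable_indic_cell b : measurable_fun setT (\1_(cell b) : SE2 R -> R).
Proof. by apply/measurable_indicP; exact: measurable_cell. Qed.

Lemma cell_integrable b (F : SE2 R -> R[i]) (M : R) : Cmeasurable setT F ->
  (forall g, normc (F g) <= M) ->
  Cintegrable (@haar R) (fun g => F g * (\1_(cell b) g)%:C%C).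
Proof.
move=> mF FM; apply: (@le_Cintegrable _ _ _ _ _ (fun g => M * \1_(cell b) g)).
- apply: CmeasurableM => //; apply: Cmeasurable_real.
  exact: measurable_indic_cell.
- under eq_fun do rewrite EFinM; apply: integrableZl => //.
  apply/integrableP; split.
    by apply/measurable_EFinP; exact: measurable_indic_cell.
  under eq_integral do rewrite gee0_abs ?lee_fin//.
  rewrite integral_indic//; last exact: measurable_cell.
  by rewrite setIT; exact: haar_cell.
- move=> g; rewrite Normc.normcM normc_real ger0_norm//.
  by rewrite ler_wpM2r.
Qed.

(** Exactly one lattice translate of the representative lies in cell b, so the series has a single
    term and needs no summability. *)
Lemma periodization_cell b (F : SE2 R -> R[i]) (q : coset_space R) :
  periodization (fun g => F g * (\1_(cell b) g)%:C%C) q =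
  F (Z2_elt R (b - cell_of (repr q)) * repr q)%g.
Proof.
rewrite /periodization (@Csum_single _ _ _ (b - cell_of (repr q))).
  rewrite indicE mem_set; first by rewrite mulr1.
  by rewrite /cell /= cell_of_mul subrK.
move=> c cb; rewrite indicE memNset ?mulr0// /cell /= cell_of_mul => h.
by apply: cb; rewrite -h addrK.
Qed.

(** The lift of [psi] to the group: [psi] is its value at the chosen representative, a choice made
    harmless by [Psi_mul]. *)
Definition Psi (k1 k2 k3 : int) g : R[i] :=
  (Num.sqrt (2 * pi))%:C%C * expi (2 * pi * (k1%:~R * g.1 0 0 + k2%:~R * g.1 1 0))
  * expi (k3%:~R * SE2_theta g).

Lemma Psi_mul k1 k2 k3 c g : Psi k1 k2 k3 (Z2_elt R c * g)%g = Psi k1 k2 k3 g.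
Proof.
rewrite /Psi /SE2_theta Z2_mul2 Z2_mul10 Z2_mul11.
(* Translation by c adds 2 pi (k1 c1 + k2 c2) to the phase, an integer multiple of the period. *)
rewrite -(expi_period (2 * pi * (k1%:~R * g.1 0 0 + _)) (k1 * c.1 + k2 * c.2)).
rewrite intrD !intrM; congr (_ * expi _ * _); ring.
Qed.

Lemma Cmeasurable_Psi k1 k2 k3 : Cmeasurable setT (Psi k1 k2 k3).
Proof.
apply: CmeasurableM; last exact: Cmeasurable_SE2_theta.
apply: CmeasurableM; first exact: Cmeasurable_cst.
apply: Cmeasurable_expi; apply: measurable_funM => //.
by apply: measurable_funD; apply: measurable_funM => //; exact: measurable_SE2_x.
Qed.

Lemma normc_Psi k1 k2 k3 g : normc (Psi k1 k2 k3 g) = Num.sqrt (2 * pi).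
Proof.
by rewrite !Normc.normcM !normc_expi !mulr1 normc_real ger0_norm.
Qed.

End lattice_translations.

Lemma indic_le1 {R : realType} {T : Type} (A : set T) (x : T) : \1_A x <= 1 :> R.
Proof. by rewrite indicE; case: (x \in A). Qed.

Lemma ae_foralln {d} {T : measurableType d} {R : realType}
    (mu : {measure set T -> \bar R}) (P : nat -> T -> Prop) :
  (forall n, {ae mu, forall x, P n x}) -> {ae mu, forall x, forall n, P n x}.
Proof.
move=> H; have := negligible_bigcup H; apply: negligibleS => x /= nP.
by apply: contrapT => nx; apply: nP => n; apply: contrapT => h; apply: nx; exists n.
Qed.

(** * Almost everywhere convergence of the periodization, and unfolding *)

Section unfolding.
Variable R : realType.
Variable mu : {measure set (coset_space R) -> \bar R}.
Hypothesis muP : invariant_coset_measure mu.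
Implicit Types (F : SE2 R -> R[i]).

Lemma periodization_Cintegrable F : Cintegrable (@haar R) F ->
  Cintegrable mu (periodization F).
Proof. by move=> /Lq1P iF; apply/Lq1P; have [_ _ _ /(_ _ iF)[]] := muP. Qed.

Lemma Cintegral_periodization F : Cintegrable (@haar R) F ->
  Cintegral mu (periodization F) = Cintegral (@haar R) F.
Proof. by move=> /Lq1P iF; have [_ _ _ /(_ _ iF)[]] := muP. Qed.

(* Measurable because [psi] is the periodization of [Psi] cut off to a
   fundamental domain. *)
Lemma Cmeasurable_psi k1 k2 k3 : Cmeasurable setT (@psi R k1 k2 k3).
Proof.
have -> : @psi R k1 k2 k3 =
    periodization (fun g => Psi k1 k2 k3 g * (\1_(cell 0) g)%:C%C).
  by apply/funext => q; rewrite periodization_cell Psi_mul.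
apply: (Cintegrable_measurable (mu := mu)).
apply/periodization_Cintegrable/cell_integrable; first exact: Cmeasurable_Psi.
by move=> g; rewrite normc_Psi.
Qed.

(** Bounds range over naturals and finite sums over all sequences, with [undup] absorbing
    repetitions. Over the countable lattice this makes divergence a countable combination of
    measurable conditions. *)
Lemma rsummableP {T : choiceType} (a : T -> R) : (forall t, 0 <= a t) ->
  rsummable a <-> exists M : nat, forall s, \sum_(t <- undup s) a t <= M%:R.
Proof.
move=> a0; split=> [sa|[M H]].
  have fin := rsummable_esum a0 sa.
  exists (Num.truncn (fine (\esum_(t in setT) (a t)%:E))).+1 => s.
  apply: le_trans (ltW (truncnS_gt _)).
  by rewrite -lee_fin fineK// -sumEFin; apply: sum_le_esum; exact: undup_uniq.
apply: (@le_lt_trans _ _ M%:R%:E); last exact: ltry.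
apply: esum_leP => s us.
under eq_bigr do rewrite /= ger0_norm//.
by rewrite sumEFin lee_fin -[s]undup_id.
Qed.

Variable f : SE2 R -> R[i].
Hypothesis fi : Cintegrable (@haar R) f.

Definition divergent : set (SE2 R) :=
  [set g | ~ rsummable (fun c => normc (f (Z2_elt R c * g)%g))].

(** Shifting the summation index by c is a bijection of the lattice. Divergence is thus a property
    of the coset, whatever representative [repr] returns. *)
Lemma divergent_mul c g : divergent (Z2_elt R c * g)%g <-> divergent g.
Proof.
suff H : rsummable (fun d => normc (f (Z2_elt R d * (Z2_elt R c * g))%g)) <->
         rsummable (fun d => normc (f (Z2_elt R d * g)%g)).
  by split; apply: contra_not => /H.
rewrite /rsummable /summable.
rewrite [in X in _ <-> X](@reindex_esum R _ _ setT setT (fun d : int * int => d + c)).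
  rewrite (_ : esum _ _ = esum setT (fun d : int * int =>
    `|(EFin \o (fun d => normc (f (Z2_elt R d * g)%g))) (d + c)%R|)%E)//.
  by apply: eq_esum => d _ /=; rewrite mulgA Z2_eltD.
split => //.
  by move=> d e _ _ /addIr.
by move=> d _; exists (d - c) => //; rewrite subrK.
Qed.

Lemma measurable_divergent : measurable divergent.
Proof.
pose G (s : seq (int * int)) (M : nat) : set (SE2 R) :=
  [set g | \sum_(c <- undup s) normc (f (Z2_elt R c * g)%g) <= M%:R].
have -> : divergent = ~` \bigcup_M ~` \bigcup_s ~` G s M.
  apply/seteqP; split => g /=.
    move=> dg [M _] /= H; apply: dg; apply/rsummableP; first by move=> t; exact: normc_ge0.
    exists M => s; apply: contrapT => Gs; apply: H.
    by exists s.
  move=> H /rsummableP; case; first by move=> t; exact: normc_ge0.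
  move=> M HM; apply: H; exists M => // -[s _] /=; apply; exact: HM.
apply: measurableC; apply: bigcupT_measurable => M.
apply: measurableC; apply: countable_bigcupT_measurable => // s.
apply: measurableC; rewrite -[X in measurable X]setTI.
have ms : measurable_fun setT (fun g => \sum_(c <- undup s) normc (f (Z2_elt R c * g)%g)).
  apply: measurable_sum => c; apply: measurable_normc.
  apply: (Cmeasurable_comp (measurable_Z2_mul c)).
  exact: Cintegrable_measurable fi.
have -> : G s M = (fun g => \sum_(c <- undup s) normc (f (Z2_elt R c * g)%g))
    @^-1` `]-oo, M%:R].
  by apply/seteqP; split => g; rewrite /G /= in_itv.
by apply: ms => //; exact: measurable_itv.
Qed.

(* The periodization of [|f|] restricted to its divergence set is identically
   [0], since [Csum] of a divergent series is [0]: hence [f] vanishes almost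
   everywhere on that set, which must then be negligible in the quotient. *)
Lemma ae_Csummable :
  {ae mu, forall q : coset_space R, rsummable (fun c => normc (f (Z2_elt R c * repr q)%g))}.
Proof.
pose f1 g : R := normc (f g) * \1_divergent g.
have f10 g : 0 <= f1 g by rewrite mulr_ge0 ?normc_ge0.
have mf1 : measurable_fun setT f1.
  apply: measurable_funM; first exact/measurable_normc/Cintegrable_measurable/fi.
  by apply/measurable_indicP; exact: measurable_divergent.
have if1 : Cintegrable (@haar R) (fun g => (f1 g)%:C%C).
  apply: (le_Cintegrable _ (Cintegrable_normc fi)); first exact: Cmeasurable_real.
  move=> g; rewrite normc_real ger0_norm//.
  by rewrite ler_piMr ?normc_ge0// indic_le1.
(* By invariance, on each coset f1 is either |f| throughout, with a divergent sum, or zero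
   throughout. *)
have per0 q : periodization (fun g => (f1 g)%:C%C) q = 0.
  rewrite /periodization.
  have [dq|ndq] := pselect (divergent (repr q)).
    apply: Csum_divergent => //.
    have -> // : (fun c => f1 (Z2_elt R c * repr q)%g) =
            (fun c => normc (f (Z2_elt R c * repr q)%g)).
    apply/funext => c; rewrite /f1 indicE mem_set ?mulr1//.
    exact/divergent_mul.
  rewrite (@Csum_single _ _ _ 0); last first.
    move=> c _; rewrite /f1 indicE memNset ?mulr0//.
    by move/divergent_mul.
  by rewrite /f1 indicE memNset ?mulr0//; move/divergent_mul.
have int0 : \int[@haar R]_g f1 g = 0.
  have := Cintegral_periodization if1.
  rewrite (_ : periodization _ = fun=> 0); last exact/funext.
  by rewrite Cintegral0 => -[].
have i1 : (@haar R).-integrable setT (EFin \o f1) by case: if1.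
(* Zero total integral forces zero integral over cell b. There the periodization is the single value
   of f1 at the translate lying in b; being nonnegative with zero integral, it vanishes almost
   everywhere. *)
have step (b : int * int) : {ae mu, forall q : coset_space R,
    f1 (Z2_elt R (b - cell_of (repr q)) * repr q)%g = 0}.
  pose F g := (f1 g)%:C%C * (\1_(cell b) g)%:C%C.
  have m1 : Cmeasurable setT (fun g : SE2 R => (\1_(cell b) g)%:C%C : R[i]).
    by apply: Cmeasurable_real; exact: measurable_indic_cell.
  have iF : Cintegrable (@haar R) F.
    apply: (@CintegrableM _ _ _ _ _ _ 1 if1) => // g.
    by rewrite normc_real ger0_norm// indic_le1.
  have F0 : \int[@haar R]_g Re (F g) = 0.
    have FE g : Re (F g) = f1 g * \1_(cell b) g by rewrite ReZ.
    apply/eqP; rewrite eq_le Rintegral_ge0 ?andbT; last first.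
      by move=> g _; rewrite FE mulr_ge0.
    rewrite -[leRHS]int0; apply: le_Rintegral => //; first by case: iF.
    by move=> g _; rewrite FE ler_piMr// indic_le1.
  have [ip _] := periodization_Cintegrable iF.
  have := Cintegral_periodization iF => -[+ _]; rewrite F0.
  have pE q : Re (periodization F q) =
              f1 (Z2_elt R (b - cell_of (repr q)) * repr q)%g.
    by rewrite /F periodization_cell.
  move=> I0.
  have : (\int[mu]_q `|(Re (periodization F q))%:E| = 0)%E.
    have fin := integrable_fin_num measurableT ip.
    transitivity (\int[mu]_q (Re (periodization F q))%:E)%E.
      by apply: eq_integral => q _; rewrite gee0_abs// lee_fin pE.
    by rewrite -(fineK fin); congr EFin; exact: I0.
  move/ae_eq_integral_abs => /(_ measurableT (measurable_int _ ip)).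
  by apply: filterS => q /(_ I) [] H; rewrite -pE; exact: H.
have : {ae mu, forall q : coset_space R, forall b : int * int,
    f1 (Z2_elt R (b - cell_of (repr q)) * repr q)%g = 0}.
  (* Enumerating the cells leaves countably many null sets to unite; the default (0, 0) only fills
     codes that decode to nothing. *)
  pose e (n : nat) : int * int := odflt (0, 0) (choice.unpickle n).
  have stepn (n : nat) : {ae mu, forall q : coset_space R,
      f1 (Z2_elt R (e n - cell_of (repr q)) * repr q)%g = 0}.
    exact: step.
  have := ae_foralln stepn.
  by apply: filterS => q H b; have := H (choice.pickle b); rewrite /e choice.pickleK.
(* On a divergent coset f1 is |f|, and letting b run over all cells reaches every translate; all
   terms would be zero, and a series of zeros converges. *)
apply: filterS => q H; apply: contrapT => dq.
have fz c : normc (f (Z2_elt R c * repr q)%g) = 0.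
  have := H (c + cell_of (repr q)); rewrite addrK /f1 indicE mem_set ?mulr1//.
  exact/divergent_mul.
apply: dq; rewrite /rsummable /summable esum1 ?ltry// => c _.
by rewrite /= fz normr0.
Qed.

(** Where the series converges absolutely, the lattice-invariant factor enters the sum by [CsumZr].
    The product is then almost everywhere a periodization, to which the defining identity of [mu]
    applies. *)
Lemma Cinner_periodization_psi k1 k2 k3 :
  Cinner mu (periodization f) (@psi R k1 k2 k3) =
  Cintegral (@haar R) (fun g => f g * conjc (Psi k1 k2 k3 g)).
Proof.
have iF : Cintegrable (@haar R) (fun g => f g * conjc (Psi k1 k2 k3 g)).
  apply: (@CintegrableM _ _ _ _ _ _ (Num.sqrt (2 * pi)) fi).
    exact/Cmeasurable_conjc/Cmeasurable_Psi.
  by move=> g; rewrite normc_conjc normc_Psi.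
rewrite -(Cintegral_periodization iF) /Cinner; apply: ae_eq_Cintegral.
- apply: CmeasurableM; last exact/Cmeasurable_conjc/Cmeasurable_psi.
  exact/Cintegrable_measurable/periodization_Cintegrable.
- exact/Cintegrable_measurable/periodization_Cintegrable.
have := ae_Csummable; apply: filterS => q sq _.
rewrite /periodization -CsumZr.
  by congr Csum; apply/funext => c; rewrite Psi_mul.
exact: sq.
Qed.

End unfolding.

Theorem theorem5p13 (R : realType)
    (mu : {measure set (coset_space R) -> \bar R})
    (mu_inv : invariant_coset_measure mu)
    (f : SE2 R -> R[i])
    (f_L1 : Lq (@haar R) 1%:E f) (f_L2 : Lq (@haar R) 2%:E f)
    (f_adm : admissible f)
    (ft_L2 : Lq mu 2%:E (periodization f))
    (fhat_H1 : H1_field (fourier f))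
    (k1 k2 k3 : int) :
  let rho : R := polar_rho k1%:~R k2%:~R in
  let Phi : R := polar_Phi k1%:~R k2%:~R in
  (rho != 0 ->
    let a (n : int) : R[i] :=
      expi (- (n%:~R * Phi)) * fourier_coef f (2 * pi * rho) n (- k3) in
    Csummable a /\
    Cinner mu (periodization f) (@psi R k1 k2 k3) =
      (Num.sqrt (2 * pi))%:C%C * expi (- (k3%:~R * Phi)) * Csum a) /\
  (rho = 0 ->
    Cinner mu (periodization f) (@psi R k1 k2 k3) =
      (Num.sqrt (2 * pi))%:C%C * theta_coef f k3).
Proof.
move=> rho Phi; have fi := (Lq1P _ _).1 f_L1.
rewrite (Cinner_periodization_psi mu_inv fi).
have conj_Psi g : conjc (Psi k1 k2 k3 g) = (Num.sqrt (2 * pi))%:C%C *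
    expi (- (2 * pi * (k1%:~R * g.1 0 0 + k2%:~R * g.1 1 0)))
    * expi (- (k3%:~R * SE2_theta g)).
  by rewrite /Psi !rmorphM !expiN; congr (_ * _ * _); exact: conjc_real.
have [_ k1E k2E] := polar_PhiP (k1%:~R : R) k2%:~R; rewrite -/rho -/Phi in k1E k2E.
split=> [rho0 a|rho0].
  have p0 : 0 < 2 * pi * rho.
    by rewrite !mulr_gt0 ?pi_gt0// lt_def rho0 sqrtr_ge0.
  have sa : Csummable a by exact: admissible_Csummable.
  split => //; rewrite /a (Csum_fourier_coef fi sa) -CintegralZ; last first.
    exact: Cintegrable_angular_limit.
  congr Cintegral; apply/funext => g.
  (* With p = 2 pi rho, m = -k3 and c = Phi the plane wave is the lattice character, since (k1, k2)
     = rho u_Phi. The remaining factor exp(i k3 (Phi - theta)) loses its Phi to the prefactor exp(-i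
     k3 Phi). *)
  rewrite conj_Psi /angular_limit /plane_wave k1E k2E.
  have -> : 2 * pi * rho * (cos Phi * g.1 0 0 + sin Phi * g.1 1 0) =
     2 * pi * (rho * cos Phi * g.1 0 0 + rho * sin Phi * g.1 1 0) by ring.
  have -> : - ((- k3)%:~R * (Phi - SE2_theta g)) =
     k3%:~R * Phi + - (k3%:~R * SE2_theta g) :> R by rewrite mulrNz; ring.
  rewrite [in RHS]expiD.
  have := expiD (- (k3%:~R * Phi)) (k3%:~R * Phi); rewrite addNr expi0 => e1.
  set s := (Num.sqrt _)%:C%C; set u := expi (- (2 * pi * _)).
  set v := expi (- (k3%:~R * SE2_theta g)).
  transitivity (f g * (s * u * v) * 1); first by rewrite mulr1.
  by rewrite e1; ring.
(* A zero radius means k1 = k2 = 0, so only the rotational character of [Psi] survives. *)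
have k0 : (k1%:~R : R) = 0 /\ (k2%:~R : R) = 0 by rewrite k1E k2E rho0 !mul0r.
rewrite /theta_coef -CintegralZ.
  congr Cintegral; apply/funext => g; rewrite conj_Psi k0.1 k0.2.
  by rewrite !mul0r addr0 mulr0 oppr0 expi0 mulr1 mulrCA.
apply: (@CintegrableM _ _ _ _ _ _ 1 fi); last by move=> g; rewrite normc_expi.
have := @Cmeasurable_SE2_theta R (- k3).
by congr Cmeasurable; apply/funext => g; rewrite mulrNz mulNr.
Qed.
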